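(* Let $T_n$ be as defined in the context, with $T_0=1$, and let $a(p,t) = -2p^{5}t^{3}+2p^{4}t^{4}+4p^{5}t^{2}-8p^{4}t^{3}-2p^{5}t+12p^{4}t^{2}-8p^{4}t+6p^{3}t-4p^{2}t^{2}+16p^{2}-10pt+20p+6$, $b(p,t) = -p^2t(2+p-t)(p-3t+6)$, $c(p,t) = p^{6}t^{2}-2p^{5}t^{3}+p^{4}t^{4}+4p^{5}t^{2}-4p^{4}t^{3}-2p^{5}t+6p^{4}t^{2}-4p^{4}t+2p^{3}t-p^{2}t^{2}+4p^{2}-2pt+4p+1$, $d(p,t) = -p^2t(2+p-t)^2$. Then for all integers $n>1$, $$T_n = n!\cdot\int_0^{\infty} [p^n]\ \left(\frac{a(p,t)\, d(p,t)-b(p,t)\, c(p,t)}{d(p,t)\, \sqrt{c(p,t)^2 - 4 p^2 d(p,t)^2}} + \frac{b(p,t)}{d(p,t)}\right) e^{-t}\, dt.$$ Correspondingly, the exponential generating function of $(T_n)$ equals $$\sum_{n=0}^{\infty} T_n \frac{x^n}{n!} = - 2 + 2x - 2x\, e^{-x-2}\, \operatorname{Ei}(x+2) + \int_0^{\infty} \frac{\big( t^{3}x^{2}+ ( -2x^{3}-4x^{2}-x ) t^{2}+ ( x^{4}+4x^{3}+7x^{2}+4x+3 ) t-6x^{2}-9x-6 \big)\, e^{-t}}{(t-(x+2)) \sqrt{\big( t^{2}x^{2}-tx^{3}-2tx^{2}-3xt+4x^{2}+4x+1 \big) \big( t^{2}x^{2}-tx^{3}-2tx^{2}+xt+1 \big)}}\,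 dt,$$ where $\operatorname{Ei}$ is the exponential integral.
   Context: For $n\ge1$, $T_n$ is the number of ways to seat $n$ married couples (each couple consisting of one woman and one man) at $2n$ distinguishable seats arranged around a circular table so that no two spouses occupy adjacent seats and no three cyclically consecutive seats are occupied by people of the same sex; by convention $T_0=1$ (and $T_1=0$). In the formula for $T_n$, the expression in parentheses is expanded as a formal Laurent series in $p$ with coefficients rational in $t$ (the square root being the one with constant term $1$), and $[p^n]$ extracts the coefficient of $p^n$, which is a polynomial in $t$. The generating-function identity is understood in the formal sense used in the paper: integrals $\int_0^\infty g\,e^{-t}\,dt$ are evaluated by the series Laplace transform (replacing each power $t^k$ in an expansion of $g$ by $k!$), and in particular the term $-2x e^{-x-2}\operatorname{Ei}(x+2)$ arises as the formal evaluation of $\int_0^\infty \frac{x-3t+6}{x-t+2}e^{-t}dt - 3$ via $\sum_{k\ge0}k!\,y^k=\frac{e^{-1/y}}{y}\operatorname{Ei}(1/y)$ with $y = 1/(x+2)$. *)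

(* Defs.v *)
From HB Require Import structures.
From mathcomp Require Export all_boot all_order all_algebra.
From mathcomp Require Export all_classical all_reals all_analysis.

Set Implicit Arguments.
Unset Strict Implicit.
Unset Printing Implicit Defensive.

Export Order.TTheory GRing.Theory Num.Theory.
Export numFieldNormedType.Exports.

Local Open Scope classical_set_scope.
Local Open Scope ring_scope.

(* Person (i, s) is the member of sex s of couple i. An injective map from
   the 2n seats to the 2n persons is a bijection; the seats are labelled, so
   rotations and reflections are not identified. ordS is the cyclic
   successor modulo 2n. *)
Definition seating (n : nat) : Type := {ffun 'I_(2 * n) -> 'I_n * bool}.

Definition admissible (n : nat) (s : seating n) : bool :=
  [&& injectiveb s,
      [forall i, (s i).1 != (s (ordS i)).1] &
      [forall i, ~~ (((s i).2 == (s (ordS i)).2) &&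
                     ((s (ordS i)).2 == (s (ordS (ordS i))).2))]].

Definition menage_T (n : nat) : nat :=
  #|[set s : {ffun 'I_(2 * n) -> 'I_n * bool} | @admissible n s]%SET|.

(* There is exactly one empty seating, in accordance with T_0 = 1. *)
Lemma menage_T0 : menage_T 0 = 1%N.
Proof.
have all_adm (s : seating 0) : admissible s.
  by apply/and3P; split; [apply/injectiveP | apply/forallP | apply/forallP];
    case.
rewrite /menage_T (eq_card (B := [set: {ffun 'I_(2 * 0) -> 'I_0 * bool}]%SET)).
  by rewrite cardsT card_ffun card_ord expn0.
by move=> s; rewrite !inE all_adm.
Qed.

Lemma menage_T1 : menage_T 1 = 0%N.
Proof.
apply/eqP; rewrite cards_eq0; apply/eqP/setP => s; rewrite !inE.
apply/negP => /and3P[_ /forallP/(_ ord0)]; by rewrite !ord1 eqxx.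
Qed.

(* A formal power series is the sequence of its coefficients. *)
Definition fps (K : Type) : Type := nat -> K.

Definition fps_poly (K : nzRingType) (P : {poly K}) : fps K := fun n => P`_n.

Definition fps_mul (K : nzRingType) (f g : fps K) : fps K :=
  fun n => \sum_(i < n.+1) f i * g (n - i)%N.

(* Inverse of a series with f 0 != 0: the list of its first n coefficients,
   by the usual recursion. *)
Fixpoint fps_inv_seq (K : fieldType) (f : fps K) (n : nat) : seq K :=
  if n is m.+1 then
    let s := fps_inv_seq f m in
    rcons s (((m == 0%N)%:R - \sum_(i < m) s`_i * f (m - i)%N) / f 0%N)
  else [::].

Definition fps_inv (K : fieldType) (f : fps K) : fps K :=
  fun n => (fps_inv_seq f n.+1)`_n.

(* Square root with constant term 1 of a series with f 0 = 1, in
   characteristic 0. *)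
Fixpoint fps_sqrt_seq (K : fieldType) (f : fps K) (n : nat) : seq K :=
  if n is m.+1 then
    let s := fps_sqrt_seq f m in
    rcons s (if m == 0%N then 1
             else (f m - \sum_(1 <= i < m) s`_i * s`_(m - i)) / 2)
  else [::].

Definition fps_sqrt (K : fieldType) (f : fps K) : fps K :=
  fun n => (fps_sqrt_seq f n.+1)`_n.

Lemma size_fps_inv_seq (K : fieldType) (f : fps K) n :
  size (fps_inv_seq f n) = n.
Proof. by elim: n => //= n IHn; rewrite size_rcons IHn. Qed.

Lemma size_fps_sqrt_seq (K : fieldType) (f : fps K) n :
  size (fps_sqrt_seq f n) = n.
Proof. by elim: n => //= n IHn; rewrite size_rcons IHn. Qed.

Lemma nth_fps_inv_seq (K : fieldType) (f : fps K) n i :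
  (i < n)%N -> (fps_inv_seq f n)`_i = fps_inv f i.
Proof.
elim: n => // n IHn; rewrite ltnS leq_eqVlt => /predU1P[->//|lt_in].
by rewrite /= nth_rcons size_fps_inv_seq lt_in IHn.
Qed.

Lemma nth_fps_sqrt_seq (K : fieldType) (f : fps K) n i :
  (i < n)%N -> (fps_sqrt_seq f n)`_i = fps_sqrt f i.
Proof.
elim: n => // n IHn; rewrite ltnS leq_eqVlt => /predU1P[->//|lt_in].
by rewrite /= nth_rcons size_fps_sqrt_seq lt_in IHn.
Qed.

Lemma fps_mulVf (K : fieldType) (f : fps K) :
  f 0%N != 0 -> forall n, fps_mul (fps_inv f) f n = (n == 0%N)%:R.
Proof.
move=> f0 n; rewrite /fps_mul big_ord_recr /= subnn.
have -> : fps_inv f n =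
    ((n == 0%N)%:R - \sum_(i < n) fps_inv f i * f (n - i)%N) / f 0%N.
  rewrite {1}/fps_inv /= nth_rcons size_fps_inv_seq ltnn eqxx.
  by congr ((_ - _) / _); apply: eq_bigr => i _; rewrite nth_fps_inv_seq.
by rewrite divfK // addrC subrK.
Qed.

Lemma fps_sqrt0 (K : fieldType) (f : fps K) : fps_sqrt f 0%N = 1.
Proof. by []. Qed.

Lemma fps_sqrtK (K : fieldType) (f : fps K) :
  2 != 0 :> K -> f 0%N = 1 ->
  forall n, fps_mul (fps_sqrt f) (fps_sqrt f) n = f n.
Proof.
move=> two f0 [|n]; first by rewrite /fps_mul big_ord1 /= fps_sqrt0 mulr1 f0.
have E : fps_sqrt f n.+1 = (f n.+1 -
    \sum_(1 <= i < n.+1) fps_sqrt f i * fps_sqrt f (n.+1 - i)%N) / 2.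
  rewrite {1}/fps_sqrt [in LHS]/fps_sqrt_seq -/(fps_sqrt_seq f n.+1).
  rewrite nth_rcons size_fps_sqrt_seq ltnn eqxx /=.
  congr ((_ - _) / _); apply: eq_big_nat => i /andP[i0 lt_in].
  rewrite -/(fps_sqrt_seq f n.+1) !nth_fps_sqrt_seq //.
  by rewrite ltn_subrL i0.
rewrite /fps_mul -(big_mkord xpredT
  (fun i => fps_sqrt f i * fps_sqrt f (n.+1 - i)%N)).
rewrite big_nat_recr //= big_ltn // subn0 subnn fps_sqrt0 mul1r mulr1.
set u := \sum_(1 <= i < n.+1) _ in E *.
by rewrite addrAC -mulr2n -mulr_natr E divfK // subrK.
Qed.

(* Laurent k f stands for p^(-k) * sum_n f n p^n. The representation is not
   unique; only coefficients are ever compared. *)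
Record laurent (K : Type) := Laurent { lshift : nat; lbody : fps K }.

Definition lcoef (K : Type) (f : laurent K) (n : nat) : K :=
  lbody f (n + lshift f).

Definition lau (K : Type) (f : fps K) : laurent K := Laurent 0 f.

Definition fps_shift (K : nzRingType) (k : nat) (f : fps K) : fps K :=
  fun n => if (n < k)%N then 0 else f (n - k)%N.

Definition ladd (K : nzRingType) (f g : laurent K) : laurent K :=
  Laurent (lshift f + lshift g)
    (fun n => fps_shift (lshift g) (lbody f) n
              + fps_shift (lshift f) (lbody g) n).

Definition lmul (K : nzRingType) (f g : laurent K) : laurent K :=
  Laurent (lshift f + lshift g) (fps_mul (lbody f) (lbody g)).

Definition fps_ord (K : fieldType) (f : fps K) : nat :=
  if pselect (exists n, f n != 0) is left h then ex_minn h else 0%N.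

(* If the body of f is p^v * g with g 0 != 0, then the inverse of
   p^(-k) p^v g is p^(-v) (p^k g^-1). *)
Definition linv (K : fieldType) (f : laurent K) : laurent K :=
  let v := fps_ord (lbody f) in
  Laurent v
    (fps_shift (lshift f) (fps_inv (fun n => lbody f (n + v)%N))).

Definition ldiv (K : fieldType) (f g : laurent K) : laurent K :=
  lmul f (linv g).

Definition pol_a (A : comNzRingType) (p t : A) : A :=
  - 2 * p ^+ 5 * t ^+ 3 + 2 * p ^+ 4 * t ^+ 4 + 4 * p ^+ 5 * t ^+ 2
  - 8 * p ^+ 4 * t ^+ 3 - 2 * p ^+ 5 * t + 12 * p ^+ 4 * t ^+ 2
  - 8 * p ^+ 4 * t + 6 * p ^+ 3 * t - 4 * p ^+ 2 * t ^+ 2 + 16 * p ^+ 2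
  - 10 * p * t + 20 * p + 6.

Definition pol_b (A : comNzRingType) (p t : A) : A :=
  - p ^+ 2 * t * (2 + p - t) * (p - 3 * t + 6).

Definition pol_c (A : comNzRingType) (p t : A) : A :=
  p ^+ 6 * t ^+ 2 - 2 * p ^+ 5 * t ^+ 3 + p ^+ 4 * t ^+ 4
  + 4 * p ^+ 5 * t ^+ 2 - 4 * p ^+ 4 * t ^+ 3 - 2 * p ^+ 5 * t
  + 6 * p ^+ 4 * t ^+ 2 - 4 * p ^+ 4 * t + 2 * p ^+ 3 * t
  - p ^+ 2 * t ^+ 2 + 4 * p ^+ 2 - 2 * p * t + 4 * p + 1.

Definition pol_d (A : comNzRingType) (p t : A) : A :=
  - p ^+ 2 * t * (2 + p - t) ^+ 2.

Definition ratfun (R : realType) : fieldType := {fraction {poly R}}.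

Definition ratfun_poly (R : realType) (q : {poly R}) : ratfun R := tofrac q.

(* The constant t of the polynomial ring R(t)[p] (or R(t)[x]), whose
   variable is 'X. *)
Definition tvar (R : realType) : {poly ratfun R} := (ratfun_poly 'X)%:P.

Definition T_series (R : realType) : laurent (ratfun R) :=
  let p : {poly ratfun R} := 'X in
  let t := tvar R in
  let a := pol_a p t in let b := pol_b p t in
  let c := pol_c p t in let d := pol_d p t in
  let L P := lau (fps_poly P) in
  ladd
    (ldiv (L (a * d - b * c))
          (lmul (L d)
                (lau (fps_sqrt (fps_poly (c ^+ 2 - 4 * p ^+ 2 * d ^+ 2))))))
    (ldiv (L b) (L d)).

Definition egf_num (A : comNzRingType) (x t : A) : A :=
  t ^+ 3 * x ^+ 2 + (- 2 * x ^+ 3 - 4 * x ^+ 2 - x) * t ^+ 2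
  + (x ^+ 4 + 4 * x ^+ 3 + 7 * x ^+ 2 + 4 * x + 3) * t
  - 6 * x ^+ 2 - 9 * x - 6.

Definition egf_rad (A : comNzRingType) (x t : A) : A :=
  (t ^+ 2 * x ^+ 2 - t * x ^+ 3 - 2 * t * x ^+ 2 - 3 * x * t
   + 4 * x ^+ 2 + 4 * x + 1)
  * (t ^+ 2 * x ^+ 2 - t * x ^+ 3 - 2 * t * x ^+ 2 + x * t + 1).

(* A power series in x over R(t): the denominator has constant term t - 2. *)
Definition egf_integrand (R : realType) : fps (ratfun R) :=
  let x : {poly ratfun R} := 'X in
  let t := tvar R in
  fps_mul (fps_poly (egf_num x t))
    (fps_inv (fps_mul (fps_poly (t - (x + 2)))
                      (fps_sqrt (fps_poly (egf_rad x t))))).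

Definition taylor0 (R : realType) (f : R -> R) : fps R :=
  fun n => derive1n n f 0 / n`!%:R.

(* The exponential integral on z > 0: the Cauchy principal value of the
   integral of e^s / s over ]-oo, z]. *)
Definition Ei (R : realType) (z : R) : R :=
  lim ((\int[lebesgue_measure]_(s in `]-oo, (- e)%R]) (expR s / s)
        + \int[lebesgue_measure]_(s in `[e, z]) (expR s / s))
       @[e --> (0 : R)^'+]).

(* Laplace transform at 1 of the geometric series 1 / (z - t) =
   sum_k t^k z^(-k-1) for z > 0. Termwise it is the divergent series
   sum_k k! z^(-k-1); its sum is the Cauchy principal value of the integral
   of e^(-t) / (z - t) over [0, +oo[. *)
Definition laplace_geom (R : realType) (z : R) : R :=
  lim ((\int[lebesgue_measure]_(t in `[0%R, (z - e)%R]) (expR (- t) / (z - t))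
        + \int[lebesgue_measure]_(t in `[(z + e)%R, +oo[)
            (expR (- t) / (z - t)))
       @[e --> (0 : R)^'+]).

(* formal_laplace g v: the formal integral of g(t) e^(-t) over [0, +oo[ is v,
   for a rational function g with no pole outside t = 2, given by its partial
   fractions. Powers t^k are sent to k!. Since
     1 / (x + 2 - t) = sum_j (-1)^j x^j / (2 - t)^(j+1),
   the fraction 1 / (2 - t)^(j+1) is sent to (-1)^j times the coefficient of
   x^j in laplace_geom (x + 2). *)
Definition formal_laplace (R : realType) (g : ratfun R) (v : R) : Prop :=
  exists (q : {poly R}) (m : nat) (r : 'I_m -> R),
    g = ratfun_poly q
        + \sum_(j < m) ratfun_poly (r j)%:P / ratfun_poly (2 - 'X) ^+ j.+1
    /\ v = \sum_(k < size q) q`_k * k`!%:R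
           + \sum_(j < m) r j * ((-1) ^+ j
               * taylor0 (fun x => laplace_geom (x + 2)) j).

(* Main.v *)
(* Inclusion-exclusion over the set of adjacent couples gives, for n > 1,
     T_n = n! sum_w sum_D (-1)^|D| (n - |D|)!,
   where w runs over the sex patterns with n men and no three consecutive equal
   sexes, and D over the sets of disjoint pairs of adjacent seats of opposite
   sex. Hence T_n = n! int P_n(t) e^(-t) dt with
   P_n = sum_w sum_D (-1)^|D| t^(n - |D|).

   Let x and y mark men and women, p = x y, and let -1/t weigh a pair of D.
   The circular words are counted by the traces of the powers of a transfer
   matrix, so their generating function is -theta(Delta) / Delta, where theta
   is the Euler derivative in x and y and Delta is the determinant. After the
   rescaling p -> t p, Delta = A + C x + C y with
     A = 1 + (2 - t) p + t p^2 (2 + p - t) and C = p (2 + p - t).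
   Writing Delta = kappa (1 + alpha x) (1 + alpha y), only kappa contributes to
   the powers of p alone: sum_n P_n p^n = -2 theta(kappa) / kappa. As kappa is
   the root (A + sqrt (A^2 - 4 t p C^2)) / 2 of a quadratic equation whose
   discriminant is egf_rad, this is -6 + b/d + egf_integrand, and
   c^2 - 4 p^2 d^2 = A^2 egf_rad turns it into the Laurent expression.

   The polar part of the coefficients of egf_integrand comes from -b/d alone.
   It is integrated through laplace_geom z = exp (- z) Ei z, which holds before
   the limit by the substitution s = z - t. *)
From HB Require Import structures.
Require Import Defs.
From mathcomp Require Import ring lra zify measurable_realfun.

Set Implicit Arguments.
Unset Strict Implicit.
Unset Printing Implicit Defensive.

Local Open Scope ring_scope.

(** * The ring of formal power series *)

(* A record rather than [nat -> K], so that the product is not mistaken for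
   the pointwise one. *)
Record pser (K : Type) := PSer { pcoef : fps K }.

Lemma pserP (K : Type) (f g : pser K) :
  (forall n, pcoef f n = pcoef g n) -> f = g.
Proof. by case: f g => f [g] /= fg; congr PSer; apply/funext. Qed.

HB.instance Definition _ (K : Type) := gen_eqMixin (pser K).
HB.instance Definition _ (K : Type) := gen_choiceMixin (pser K).

Section PowerSeriesRing.
Variable K : comNzRingType.
Implicit Types f g h : pser K.

Definition pser_add f g := PSer (fun n => pcoef f n + pcoef g n).
Definition pser_opp f := PSer (fun n => - pcoef f n).
Definition pser_zero : pser K := PSer (fun=> 0).
Definition pser_mul f g := PSer (fps_mul (pcoef f) (pcoef g)).
Definition pser_one : pser K := PSer (fun n => (n == 0%N)%:R).

Fact pser_addA : associative pser_add.
Proof. by move=> f g h; apply: pserP => n /=; rewrite addrA. Qed.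
Fact pser_addC : commutative pser_add.
Proof. by move=> f g; apply: pserP => n /=; rewrite addrC. Qed.
Fact pser_add0 : left_id pser_zero pser_add.
Proof. by move=> f; apply: pserP => n /=; rewrite add0r. Qed.
Fact pser_addN : left_inverse pser_zero pser_opp pser_add.
Proof. by move=> f; apply: pserP => n /=; rewrite addNr. Qed.

HB.instance Definition _ := GRing.isZmodule.Build (pser K)
  pser_addA pser_addC pser_add0 pser_addN.

(** Commutativity and associativity are inherited from [{poly K}]: the coefficients of index below
    [m] of a product depend only on the truncations of its factors at [m]. *)
Definition pser_trunc m f : {poly K} := \poly_(i < m) pcoef f i.

Fact pser_mul_trunc m f g n : (n < m)%N ->
  pcoef (pser_mul f g) n = (pser_trunc m f * pser_trunc m g)`_n.
Proof.
move=> nm; rewrite coefM; apply: eq_bigr => -[i /= ilt] _.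
rewrite !coef_poly (leq_ltn_trans _ nm) // (leq_ltn_trans _ nm) //.
by rewrite leq_subr.
Qed.

Fact coef_mul_trunc m f g (p : {poly K}) n : (n < m)%N ->
  (pser_trunc m (pser_mul f g) * p)`_n
    = (pser_trunc m f * pser_trunc m g * p)`_n.
Proof.
move=> nm; rewrite !coefM; apply: eq_bigr => -[i /= ilt] _.
have im : (i < m)%N by apply: leq_ltn_trans nm.
by rewrite {1}/pser_trunc coef_poly im (@pser_mul_trunc m).
Qed.

Fact pser_mulC : commutative pser_mul.
Proof.
by move=> f g; apply: pserP => n; rewrite !(@pser_mul_trunc n.+1) // mulrC.
Qed.
Fact pser_mulA : associative pser_mul.
Proof.
move=> f g h; apply: pserP => n; rewrite pser_mulC.
rewrite !(@pser_mul_trunc n.+1) // !coef_mul_trunc //.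
by congr (polyseq _)`_n; ring.
Qed.
Fact pser_mul1 : left_id pser_one pser_mul.
Proof.
move=> f; apply: pserP => n /=; rewrite /fps_mul big_ord_recl /= subn0 mul1r.
by rewrite big1 ?addr0 // => i _; rewrite mul0r.
Qed.
Fact pser_mulDl : left_distributive pser_mul pser_add.
Proof.
move=> f g h; apply: pserP => n /=; rewrite /fps_mul -big_split /=.
by apply: eq_bigr => i _; rewrite mulrDl.
Qed.
Fact pser_1neq0 : pser_one != 0.
Proof.
apply/eqP => /(congr1 (fun f => pcoef f 0)) /= /eqP; by rewrite oner_eq0.
Qed.

HB.instance Definition _ := GRing.Zmodule_isComNzRing.Build (pser K)
  pser_mulA pser_mulC pser_mul1 pser_mulDl pser_1neq0.

Lemma pcoefD f g n : pcoef (f + g) n = pcoef f n + pcoef g n.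
Proof. by []. Qed.
Lemma pcoefN f n : pcoef (- f) n = - pcoef f n.
Proof. by []. Qed.
Lemma pcoefB f g n : pcoef (f - g) n = pcoef f n - pcoef g n.
Proof. by []. Qed.
Lemma pcoef1 n : pcoef (1 : pser K) n = (n == 0%N)%:R.
Proof. by []. Qed.
Lemma pcoefM f g n :
  pcoef (f * g) n = \sum_(i < n.+1) pcoef f i * pcoef g (n - i)%N.
Proof. by []. Qed.
Lemma pcoefM0 f g : pcoef (f * g) 0 = pcoef f 0 * pcoef g 0.
Proof. by rewrite pcoefM big_ord1. Qed.
Lemma pcoef_sum (I : Type) (r : seq I) (P : pred I) (F : I -> pser K) n :
  pcoef (\sum_(i <- r | P i) F i) n = \sum_(i <- r | P i) pcoef (F i) n.
Proof. by elim/big_rec2: _ => // i y f _ <-. Qed.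

Definition poly_pser (p : {poly K}) : pser K := PSer (fps_poly p).

Fact poly_pser_zmod : zmod_morphism poly_pser.
Proof.
move=> p q; apply: pserP => n; rewrite pcoefB /=.
exact: (coefB p q n).
Qed.
Fact poly_pser_monoid : monoid_morphism poly_pser.
Proof.
split; first by apply: pserP => n; rewrite pcoef1 /= /fps_poly coef1.
by move=> p q; apply: pserP => n /=; rewrite /fps_poly coefM.
Qed.
HB.instance Definition _ := GRing.isZmodMorphism.Build _ _ poly_pser
  poly_pser_zmod.
HB.instance Definition _ := GRing.isMonoidMorphism.Build _ _ poly_pser
  poly_pser_monoid.

Lemma pcoef_poly p n : pcoef (poly_pser p) n = p`_n.
Proof. by []. Qed.

Lemma pcoefCM c f n : pcoef (poly_pser c%:P * f) n = c * pcoef f n.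
Proof.
rewrite pcoefM big_ord_recl subn0 pcoef_poly coefC big1 ?addr0 // => i _.
by rewrite pcoef_poly coefC mul0r.
Qed.

Lemma pcoefXM f n :
  pcoef (poly_pser 'X * f) n = if n is m.+1 then pcoef f m else 0.
Proof.
case: n => [|n]; first by rewrite pcoefM0 pcoef_poly coefX mul0r.
rewrite pcoefM big_ord_recl pcoef_poly coefX mul0r add0r.
rewrite big_ord_recl pcoef_poly coefX mul1r big1 ?addr0 => [|i _].
  by rewrite /= subSS subn0.
by rewrite pcoef_poly coefX mul0r.
Qed.

Lemma pcoefXnM f k n :
  pcoef (poly_pser 'X^k * f) n = if (n < k)%N then 0 else pcoef f (n - k)%N.
Proof.
elim: k n => [|k IHk] n; first by rewrite expr0 rmorph1 mul1r subn0.
rewrite exprS rmorphM -mulrA pcoefXM; case: n => [|n]; first by [].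
by rewrite IHk ltnS subSS.
Qed.


(** The Euler derivative [X d/dX]. *)
Definition theta f : pser K := PSer (fun n => pcoef f n *+ n).

Lemma thetaD f g : theta (f + g) = theta f + theta g.
Proof. by apply: pserP => n /=; rewrite mulrnDl. Qed.
Lemma thetaN f : theta (- f) = - theta f.
Proof. by apply: pserP => n /=; rewrite mulNrn. Qed.
Lemma thetaM f g : theta (f * g) = theta f * g + f * theta g.
Proof.
apply: pserP => n; rewrite pcoefD !pcoefM /= -sumrMnl -big_split /=.
apply: eq_bigr => -[i /= ilt] _; rewrite mulrnAl mulrnAr -mulrnDr.
by rewrite subnKC.
Qed.
Lemma theta1 : theta 1 = 0.
Proof. by apply: pserP => -[|n] //=; rewrite mul0rn. Qed.
Lemma theta0 : theta 0 = 0.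
Proof. by apply: pserP => n /=; rewrite mul0rn. Qed.
Lemma thetaX : theta (poly_pser 'X) = poly_pser 'X.
Proof.
apply: pserP => n /=; rewrite /fps_poly coefX.
by case: n => [|[|n]] //; rewrite mul0rn.
Qed.
Lemma thetaC c : theta (poly_pser c%:P) = 0.
Proof.
apply: pserP => -[|n] //=; rewrite /fps_poly coefC /= ?mulr0n //.
by rewrite mul0rn.
Qed.
Lemma theta_nat k : theta k%:R = 0.
Proof. by elim: k => [|k IHk]; rewrite ?theta0 // -natr1 thetaD IHk theta1 addr0. Qed.
Lemma thetaMl_nat k f : theta (k%:R * f) = k%:R * theta f.
Proof. by rewrite thetaM theta_nat mul0r add0r. Qed.
End PowerSeriesRing.

(** * Inverses and square roots of power series *)

Section PowerSeriesField.
Variable K : fieldType.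
Implicit Types f g : pser K.

Lemma pser_mulVf f :
  pcoef f 0 != 0 -> PSer (fps_inv (pcoef f)) * f = 1.
Proof. by move=> f0; apply: pserP => n; apply: fps_mulVf. Qed.

Lemma pser_mulfI f : pcoef f 0 != 0 -> injective (fun g => f * g).
Proof.
move=> f0 g h fgh; rewrite -[g]mul1r -[h]mul1r -(pser_mulVf f0) -!mulrA.
by rewrite fgh.
Qed.

Lemma pser_sqrtK f : 2 != 0 :> K -> pcoef f 0 = 1 ->
  PSer (fps_sqrt (pcoef f)) ^+ 2 = f.
Proof. by move=> two f0; apply: pserP => n; apply: fps_sqrtK. Qed.

(** [f + g] has constant term 2, so it can be cancelled in [(f - g) (f + g) = 0]. *)
Lemma pser_sqrt_unique f g : 2 != 0 :> K -> pcoef f 0 = 1 -> pcoef g 0 = 1 ->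
  f ^+ 2 = g ^+ 2 -> f = g.
Proof.
move=> two f0 g0 /eqP; rewrite -subr_eq0 subr_sqr => /eqP fg.
apply/eqP; rewrite -subr_eq0; apply/eqP.
apply: (@pser_mulfI (f + g)); first by rewrite pcoefD f0 g0.
by rewrite mulr0 mulrC.
Qed.
End PowerSeriesField.

(** * Diagonal of the logarithmic derivative of [A + C x + C y] *)

Section Strip.
Variable K : fieldType.

Lemma pcoefM_eq0 (f g : pser K) n : pcoef f 0 = 0 ->
  (forall m, (m < n)%N -> pcoef g m = 0) -> pcoef (f * g) n = 0.
Proof.
move=> f0 g0; rewrite pcoefM big_ord_recl f0 mul0r add0r big1 // => i _.
by rewrite g0 ?mulr0 // ltn_subrL (leq_ltn_trans _ (ltn_ord i)).
Qed.

(* [A Y_k + C Y_(k-1) + s C Y_(k+1)] determines the coefficient of [p^n] of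
   [Y_k] from lower coefficients of the family, as [p] divides [C]. *)
Lemma strip_unique (A C s : pser K) (Y : nat -> pser K) :
  pcoef A 0 = 1 -> pcoef C 0 = 0 ->
  A * Y 0%N + 2 * s * C * Y 1%N = 0 ->
  (forall k, A * Y k.+1 + C * Y k + s * C * Y k.+2 = 0) ->
  forall k, Y k = 0.
Proof.
move=> A0 C0 Y0 YS.
(* With [A = 1 + (A - 1)], the factors [A - 1] and [C] have constant term 0, so coefficient [n] of
   [f] only involves lower coefficients. *)
have lead (f g h : pser K) n : A * f + C * g + C * h = 0 ->
    (forall m, (m < n)%N -> pcoef f m = 0) ->
    (forall m, (m < n)%N -> pcoef g m = 0) ->
    (forall m, (m < n)%N -> pcoef h m = 0) -> pcoef f n = 0.
  move=> fgh f0 g0 h0.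
  have -> : f = (A * f + C * g + C * h) - ((A - 1) * f + C * g + C * h) by ring.
  rewrite fgh sub0r.
  by rewrite pcoefN !pcoefD !pcoefM_eq0 ?addr0 ?oppr0 // pcoefB A0 pcoef1 subrr.
(* Induction on the order of vanishing, for all [k] at once. *)
have low n : forall k m, (m < n)%N -> pcoef (Y k) m = 0.
  elim: n => // n IHn k m; rewrite ltnS leq_eqVlt => /predU1P[->|]; last first.
    exact: IHn.
  have mul0 (f : pser K) j i : (i < n)%N -> pcoef (f * Y j) i = 0.
    move=> iltn; rewrite pcoefM big1 // => -[a /= ale] _.
    by rewrite IHn ?mulr0 // (leq_ltn_trans _ iltn) // leq_subr.
  case: k => [|k].
  - apply: (lead (Y 0%N) (2 * s * Y 1%N) 0 n) => // [|i|i].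
    + by rewrite -[RHS]Y0; ring.
    + exact: IHn.
    + exact: mul0.
  - apply: (lead (Y k.+1) (Y k) (s * Y k.+2) n) => // [|i|i|i].
    + by rewrite -[RHS](YS k); ring.
    + exact: IHn.
    + exact: IHn.
    + exact: mul0.
by move=> k; apply: pserP => n; apply: (low n.+1).
Qed.

(* With [kap al = C], the polynomial [A + C x + C y] ([x y = s]) factors as
   [kap (1 + al x) (1 + al y)]; the solution collects the coefficients of
   [x^k] in minus the Euler derivative of its logarithm. *)
Lemma strip_solution (A C s kap : pser K) (Z : nat -> pser K) :
  pcoef A 0 = 1 -> pcoef C 0 = 0 -> theta s = s ->
  pcoef kap 0 = 1 -> kap ^+ 2 - A * kap + s * C ^+ 2 = 0 ->
  A * Z 0%N + 2 * s * C * Z 1%N = - 2 * theta A ->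
  A * Z 1%N + C * Z 0%N + s * C * Z 2 = - (2 * theta C + C) ->
  (forall k, A * Z k.+2 + C * Z k.+1 + s * C * Z k.+3 = 0) ->
  kap * Z 0%N = - 2 * theta kap.
Proof.
move=> A0 C0 ths kap0 kapE Z0 Z1 ZS.
set ki := PSer (fps_inv (pcoef kap)).
have kiK : ki * kap = 1 by rewrite pser_mulVf // kap0 oner_eq0.
pose al : pser K := ki * C.
have Cal : C = kap * al by rewrite /al mulrA (mulrC kap) kiK mul1r.
(* The quadratic equation divided by [kap]; the right-hand side is the part of
   [kap (1 + al x) (1 + al y)] of strip 0. *)
have AE : A = kap + s * kap * al ^+ 2.
  suff : A * kap * ki = (kap ^+ 2 + s * C ^+ 2) * ki.
    rewrite -mulrA (mulrC kap) kiK mulr1 => ->.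
    rewrite Cal (_ : _ * ki = (ki * kap) * (kap + s * kap * al ^+ 2)).
      by rewrite kiK mul1r.
    by ring.
  congr (_ * _); apply/eqP; rewrite -subr_eq0 -oppr_eq0; apply/eqP.
  by rewrite -[RHS]kapE; ring.
have thA : theta A = theta kap + s * kap * al ^+ 2
    + s * (theta kap * al ^+ 2 + 2 * kap * al * theta al).
  by rewrite AE thetaD !thetaM ths; ring.
have thC : theta C = theta kap * al + kap * theta al by rewrite Cal thetaM.
(* As [p = x y] has degree 2, the factor [1 + al x] contributes
   [- (al + 2 theta al) x / (1 + al x)], a geometric series in [x], and [kap] contributes
   [- 2 theta kap / kap]. *)
pose V k : pser K := if k is j.+1 then (-1) ^+ k * (al ^+ k + 2 * al ^+ j * theta al)
            else - 2 * ki * theta kap.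
have kV0 : kap * V 0%N = - 2 * theta kap.
  have := congr1 ( *%R^~ (- 2 * theta kap)) kiK.
  by rewrite mul1r => <-; rewrite /V; ring.
suff -> : Z 0%N = V 0%N by [].
apply/eqP; rewrite -subr_eq0; apply/eqP.
(* [Z] and [V] satisfy the same recurrence, so their difference satisfies the homogeneous one. *)
pose Y k : pser K := Z k - V k.
apply: (@strip_unique A C s Y _ _ _ _ 0%N) => //.
- rewrite /Y [LHS](_ : _ = (A * Z 0%N + 2 * s * C * Z 1%N)
    - ((1 + s * al ^+ 2) * (kap * V 0%N) + 2 * s * C * V 1%N)).
    by rewrite kV0 Z0 thA Cal /V; ring.
  by rewrite AE Cal; ring.
- case=> [|k].
    rewrite /Y [LHS](_ : _ = (A * Z 1%N + C * Z 0%N + s * C * Z 2)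
      - (A * V 1%N + al * (kap * V 0%N) + s * C * V 2)).
      rewrite kV0 Z1 thC AE Cal /V /= !exprS !expr0. ring.
    by rewrite Cal; ring.
  rewrite /Y [LHS](_ : _ = (A * Z k.+2 + C * Z k.+1 + s * C * Z k.+3)
    - (A * V k.+2 + C * V k.+1 + s * C * V k.+3)); last by ring.
  by rewrite ZS AE Cal /V !exprS; ring.
Qed.
End Strip.

(** * Polynomial identities and the closed form of the diagonal *)

Definition strip_diag (A : comNzRingType) (p t : A) : A :=
  1 + (2 - t) * p + t * p ^+ 2 * (2 + p - t).
Definition strip_off (A : comNzRingType) (p t : A) : A := p * (2 + p - t).

(** The radicand is the discriminant of [kap^2 - A kap + t p C^2]. *)
Lemma egf_radE (A : comNzRingType) (p t : A) :
  egf_rad p t = strip_diag p t ^+ 2 - 4 * t * p * strip_off p t ^+ 2.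
Proof. by rewrite /egf_rad /strip_diag /strip_off; ring. Qed.

(** Hence the square root in the Laurent expression is [strip_diag] times the one in the
    integrand. *)
Lemma pol_cE (A : comNzRingType) (p t : A) :
  pol_c p t ^+ 2 - 4 * p ^+ 2 * pol_d p t ^+ 2 = strip_diag p t ^+ 2 * egf_rad p t.
Proof. by rewrite /pol_c /pol_d /egf_rad /strip_diag; ring. Qed.

(** The factor [strip_diag] will cancel the one coming out of the square root, which leaves the
    integrand. *)
Lemma pol_abcdE (A : comNzRingType) (p t : A) :
  (t - (p + 2)) * (pol_a p t * pol_d p t - pol_b p t * pol_c p t)
    = pol_d p t * (strip_diag p t * egf_num p t).
Proof.
by rewrite /pol_a /pol_b /pol_c /pol_d /egf_num /strip_diag; ring.
Qed.

Section PolynomialMorphisms.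
Variables (A B : comNzRingType) (f : {rmorphism A -> B}) (p t : A).

Let rmorphE := (rmorphM, rmorphD, rmorphB, rmorphN, rmorphXn, rmorph_nat,
  rmorph1).

Lemma rmorph_egf_num : f (egf_num p t) = egf_num (f p) (f t).
Proof. by rewrite /egf_num !rmorphE. Qed.
Lemma rmorph_egf_rad : f (egf_rad p t) = egf_rad (f p) (f t).
Proof. by rewrite /egf_rad !rmorphE. Qed.
Lemma rmorph_strip_diag : f (strip_diag p t) = strip_diag (f p) (f t).
Proof. by rewrite /strip_diag !rmorphE. Qed.
Lemma rmorph_pol_b : f (pol_b p t) = pol_b (f p) (f t).
Proof. by rewrite /pol_b !rmorphE. Qed.
Lemma rmorph_pol_d : f (pol_d p t) = pol_d (f p) (f t).
Proof. by rewrite /pol_d !rmorphE. Qed.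
End PolynomialMorphisms.

Section ClosedForm.
Variables (K : fieldType) (t : K).
Hypotheses (two : 2 != 0 :> K) (t2 : 2 - t != 0).
Let P : pser K := poly_pser 'X.
Let T : pser K := poly_pser t%:P.

Let P0 : pcoef P 0 = 0. Proof. by rewrite pcoef_poly coefX. Qed.
Let T0 : pcoef T 0 = t. Proof. by rewrite pcoef_poly coefC. Qed.
Let nat0 k : pcoef (k%:R : pser K) 0 = k%:R.
Proof. by elim: k => // k IHk; rewrite -!natr1 pcoefD IHk pcoef1. Qed.
Let coef0E := (pcoefD, pcoefN, pcoefM0, pcoef1, P0, T0, nat0, @mul0r, @mulr0,
  @addr0, @add0r, @oppr0, exprS).

Lemma strip_diag0 : pcoef (strip_diag P T) 0 = 1.
Proof. by rewrite /strip_diag !coef0E. Qed.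
Lemma strip_off0 : pcoef (strip_off P T) 0 = 0.
Proof. by rewrite /strip_off !coef0E. Qed.
Lemma egf_rad0 : pcoef (egf_rad P T) 0 = 1.
Proof.
by rewrite /egf_rad !coef0E eqxx mulr1.
Qed.

Let thetaT : theta T = 0. Proof. exact: thetaC. Qed.
Let thetaP : theta P = P. Proof. exact: thetaX. Qed.
Let thetaE := (thetaD, thetaN, thetaM, theta1, theta_nat, thetaT, thetaP).

Definition egf_sqrt : pser K := PSer (fps_sqrt (pcoef (egf_rad P T))).

Lemma egf_sqrtK : egf_sqrt ^+ 2 = egf_rad P T.
Proof. exact: pser_sqrtK two egf_rad0. Qed.

(** Here [kap = (A + S) / 2], with [S] the root of the discriminant, and [- 2 theta kap / kap]
    splits into a rational part [- 6 + J] and a part [H] with [S] in its denominator. *)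
Lemma strip_closed_form (Z : nat -> pser K) (J H : pser K) :
  let A := strip_diag P T in let C := strip_off P T in
  A * Z 0%N + 2 * (T * P) * C * Z 1%N = - 2 * theta A ->
  A * Z 1%N + C * Z 0%N + (T * P) * C * Z 2 = - (2 * theta C + C) ->
  (forall k, A * Z k.+2 + C * Z k.+1 + (T * P) * C * Z k.+3 = 0) ->
  (2 + P - T) * J = P - 3 * T + 6 ->
  (T - (P + 2)) * egf_sqrt * H = egf_num P T ->
  Z 0%N = - 6 + J + H.
Proof.
move=> A C Z0 Z1 ZS JE HE.
set S := egf_sqrt in HE; have SE : S ^+ 2 = egf_rad P T := egf_sqrtK.
have S0 : pcoef S 0 = 1 by [].
pose h : pser K := poly_pser (2^-1)%:P.
have h2 : h * 2 = 1.
  rewrite -(rmorph_nat (@poly_pser K) 2) -rmorphM -(rmorph_nat (@polyC K) 2).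
  by rewrite -polyCM mulVf ?rmorph1.
pose kap := h * (A + S).
have kap2 : A + S = 2 * kap by rewrite /kap mulrA (mulrC 2) h2 mul1r.
clearbody kap.
have kap0 : pcoef kap 0 = 1.
  have : 2 * pcoef kap 0 = 2 * 1.
    rewrite -{1}nat0 -pcoefM0 -kap2 pcoefD S0 strip_diag0; ring.
  by move/(mulfI two).
have kapE : kap ^+ 2 - A * kap + (T * P) * C ^+ 2 = 0.
  have four0 : pcoef (4 : pser K) 0 != 0.
    by rewrite nat0 (natrM _ 2 2) mulf_neq0.
  apply: (pser_mulfI four0); rewrite mulr0.
  have SA : S = 2 * kap - A by rewrite -kap2; ring.
  have : S ^+ 2 - egf_rad P T = 0 by rewrite SE subrr.
  by rewrite egf_radE SA -/A -/C => <-; ring.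
have Zk : kap * Z 0%N = - 2 * theta kap.
  apply: (@strip_solution _ A C (T * P)) kapE Z0 Z1 ZS => //.
  - exact: strip_diag0.
  - exact: strip_off0.
  - by rewrite !thetaE; ring.
(* A unit that clears all denominators. *)
have u0 : pcoef (2 * (2 + P - T) * S * kap) 0 != 0.
  by rewrite !pcoefM0 S0 kap0 !coef0E !mulr1 mulf_neq0.
apply: (pser_mulfI u0).
rewrite (_ : 2 * (2 + P - T) * S * kap * Z 0%N
  = 2 * (2 + P - T) * S * (kap * Z 0%N)); last by ring.
rewrite Zk.
have -> : 2 * (2 + P - T) * S * (-2 * theta kap)
    = - 2 * (2 + P - T) * S * theta (2 * kap) by rewrite thetaMl_nat; ring.
have -> : 2 * (2 + P - T) * S * kap * (- 6 + J + H)
    = 2 * kap * (S * (- 6 * (2 + P - T) + (2 + P - T) * J)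
        - (T - (P + 2)) * S * H) by ring.
rewrite JE HE -kap2 thetaD mulrDr.
have thS : 2 * S * theta S = theta (egf_rad P T) by rewrite -SE thetaM; ring.
have -> : -2 * (2 + P - T) * S * theta S
   = - ((2 + P - T) * theta (egf_rad P T)) by rewrite -thS; ring.
(* With [L = 3 T - 5 P - 6], [numE] and [radE] give [2 (2 + P - T) S (theta A + theta S) = (A + S)
   (egf_num - L S)], while [- 6 + J = L / (2 + P - T)]. *)
have numE : egf_num P T
    = A * (3 * T - 5 * P - 6) + 2 * (2 + P - T) * theta A.
  by rewrite /A /strip_diag /egf_num !thetaE; ring.
have radE : (2 + P - T) * theta (egf_rad P T)
    = A * egf_num P T - egf_rad P T * (3 * T - 5 * P - 6).
  by rewrite /A /strip_diag /egf_num /egf_rad !thetaE; ring.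
by rewrite radE -SE numE; ring.
Qed.
End ClosedForm.

(** * The Laurent expression and the integrand *)

Lemma fps_shiftD (K : nzRingType) (f : fps K) k m :
  fps_shift k f (m + k)%N = f m.
Proof. by rewrite /fps_shift ltnNge leq_addl addnK. Qed.

Lemma lcoefD (K : nzRingType) (f g : laurent K) n :
  lcoef (ladd f g) n = lcoef f n + lcoef g n.
Proof.
case: f g => [k f] [l g]; rewrite /lcoef /ladd /=; congr (_ + _).
  by rewrite -[n + _]/(n + (k + l))%N addnA fps_shiftD.
by rewrite -[n + _]/(n + (k + l))%N (addnC k) addnA fps_shiftD.
Qed.

(** Write [g = p^v g1] with [g1] invertible: the shift by [v] in [linv] is undone by the factor
    [p^v] of [f = g h]. *)
Lemma lcoef_ldiv (K : fieldType) (f g : fps K) (h : pser K) n :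
  PSer g * h = PSer f -> (exists m, g m != 0) ->
  lcoef (ldiv (lau f) (lau g)) n = pcoef h n.
Proof.
move=> ghf g_neq0; rewrite /lcoef /ldiv /lmul /linv /=.
set v := fps_ord g; set g1 := fun n => g (n + v)%N.
have [g10 gE] : g1 0%N != 0 /\ PSer g = poly_pser 'X^v * PSer g1.
  rewrite /g1 /v /fps_ord; case: pselect => // ex.
  case: ex_minnP => m gm mP; split=> //; apply: pserP => j.
  rewrite pcoefXnM /=; case: ltnP => [jm|mj]; last by rewrite subnK.
  by apply/eqP; apply: contraTT jm => /mP; rewrite -leqNgt.
have -> : fps_shift 0 (fps_inv g1) = fps_inv g1.
  by apply/funext => j; rewrite /fps_shift subn0.
rewrite add0n.
have -> : fps_mul f (fps_inv g1) = pcoef (PSer f * PSer (fps_inv g1)) by [].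
rewrite -ghf gE.
rewrite (_ : _ * _ = poly_pser 'X^v * (PSer (fps_inv g1) * PSer g1 * h)).
  by rewrite (pser_mulVf (f := PSer g1)) // mul1r pcoefXnM ltnNge leq_addl /= addnK.
by ring.
Qed.

Section LaurentExpression.
Variables (K : fieldType) (t : K).
Hypotheses (two : 2 != 0 :> K) (t2 : 2 - t != 0) (t_neq0 : t != 0).
Let P : pser K := poly_pser 'X.
Let T : pser K := poly_pser t%:P.

(** [b / d] in lowest terms. *)
Definition pole_part : pser K :=
  (P - 3 * T + 6) * PSer (fps_inv (pcoef (2 + P - T))).

(** [egf_integrand] and, below, [T_series] with a constant [t] of any field; conversion recovers
    them at the variable of [R(t)]. *)
Definition egf_pser : pser K :=
  PSer (fps_mul (fps_poly (egf_num 'X t%:P))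
    (fps_inv (fps_mul (fps_poly (t%:P - ('X + 2)))
                      (fps_sqrt (fps_poly (egf_rad 'X t%:P)))))).

Definition laurent_expr : laurent K :=
  let p : {poly K} := 'X in
  let a := pol_a p t%:P in let b := pol_b p t%:P in
  let c := pol_c p t%:P in let d := pol_d p t%:P in
  let L P := lau (fps_poly P) in
  ladd
    (ldiv (L (a * d - b * c))
          (lmul (L d)
                (lau (fps_sqrt (fps_poly (c ^+ 2 - 4 * p ^+ 2 * d ^+ 2))))))
    (ldiv (L b) (L d)).

Let P0 : pcoef P 0 = 0. Proof. by rewrite pcoef_poly coefX. Qed.
Let T0 : pcoef T 0 = t. Proof. by rewrite pcoef_poly coefC. Qed.

Lemma pole_den0 : pcoef (2 + P - T) 0 = 2 - t.
Proof.
by rewrite pcoefB pcoefD P0 T0 addr0 -(rmorph_nat (@poly_pser K)) pcoef_poly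
  -polyC_natr coefC.
Qed.

Lemma pole_partE : (2 + P - T) * pole_part = P - 3 * T + 6.
Proof.
rewrite /pole_part mulrC -mulrA pser_mulVf ?mulr1 //.
by rewrite pole_den0 t2.
Qed.

Lemma egf_den0 : pcoef (T - (P + 2)) 0 != 0.
Proof.
rewrite -oppr_eq0 -pcoefN (_ : - _ = 2 + P - T); last by ring.
by rewrite pole_den0 t2.
Qed.

Lemma egf_pserE : (T - (P + 2)) * egf_sqrt t * egf_pser = egf_num P T.
Proof.
have den0 : pcoef ((T - (P + 2)) * egf_sqrt t) 0 != 0.
  by rewrite pcoefM0 mulf_neq0 ?egf_den0 // oner_eq0.
rewrite (_ : egf_pser = egf_num P T *
    PSer (fps_inv (pcoef ((T - (P + 2)) * egf_sqrt t)))).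
  by rewrite mulrCA [X in _ * X]mulrC pser_mulVf // mulr1.
rewrite /egf_sqrt -(rmorph_egf_num (@poly_pser K)).
rewrite -(rmorph_egf_rad (@poly_pser K)).
by rewrite -(rmorph_nat (@poly_pser K)) -rmorphD -rmorphB.
Qed.

(** The factor [p^2] of [d] cancels in both quotients, so each of them is a power series. *)
Lemma lcoef_laurent_expr n : lcoef laurent_expr n = pcoef (egf_pser + pole_part) n.
Proof.
have dE : poly_pser (pol_d 'X t%:P)
    = poly_pser 'X^2 * (- T * ((2 + P - T) * (2 + P - T))).
  by rewrite (rmorph_pol_d (@poly_pser K)) rmorphXn /pol_d; ring.
have d_unit : pcoef (- T * ((2 + P - T) * (2 + P - T))) 0 != 0.
  rewrite (pcoefM0 (- T)) (pcoefM0 (2 + P - T)) pole_den0 pcoefN T0.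
  by rewrite mulf_neq0 ?oppr_eq0 ?t_neq0 // mulf_neq0 ?t2.
have d_neq0 : exists m, (pol_d 'X t%:P)`_m != 0.
  by exists 2%N; rewrite -pcoef_poly dE pcoefXnM subnn.
set rad := fps_poly (pol_c 'X t%:P ^+ 2
  - 4 * 'X ^+ 2 * pol_d 'X t%:P ^+ 2).
have radE : PSer rad = strip_diag P T ^+ 2 * egf_rad P T.
  rewrite -[PSer rad]/(poly_pser _) pol_cE (rmorphM (@poly_pser K)).
  rewrite (rmorphXn (@poly_pser K)) (rmorph_strip_diag (@poly_pser K)).
  by rewrite (rmorph_egf_rad (@poly_pser K)).
have sqrtE : PSer (fps_sqrt rad) = strip_diag P T * egf_sqrt t.
  apply: pser_sqrt_unique => //; first by rewrite pcoefM0 strip_diag0 mul1r.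
  rewrite (pser_sqrtK (f := PSer rad)) //.
    by rewrite radE exprMn egf_sqrtK.
  by rewrite radE pcoefM0 egf_rad0 expr2 pcoefM0 strip_diag0 !mul1r.
have dsE : PSer (fps_mul (fps_poly (pol_d 'X t%:P)) (fps_sqrt rad))
    = poly_pser (pol_d 'X t%:P) * (strip_diag P T * egf_sqrt t).
  by rewrite -sqrtE.
rewrite lcoefD pcoefD; congr (_ + _).
- apply: lcoef_ldiv; last first.
    exists 2%N; rewrite -[fps_mul _ _]/(pcoef (PSer (fps_mul _ _))) dsE dE.
    rewrite -mulrA pcoefXnM subnn.
    rewrite (pcoefM0 (- T * _)) mulf_neq0 // pcoefM0.
    by rewrite strip_diag0 mul1r oner_neq0.
  rewrite [X in X * _]dsE.
  (* Multiplication by the unit [t - (p + 2)] makes [pol_abcdE] applicable. *)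
  apply: (pser_mulfI egf_den0).
  rewrite -[PSer (fps_poly _)]/(poly_pser _).
  rewrite (_ : T - (P + 2) = poly_pser (t%:P - ('X + 2))).
    rewrite -[RHS](rmorphM (@poly_pser K)) pol_abcdE.
    rewrite [RHS](rmorphM (@poly_pser K)) (rmorphM (@poly_pser K) (strip_diag _ _)).
    rewrite (rmorph_strip_diag (@poly_pser K)) (rmorph_egf_num (@poly_pser K)).
    rewrite -/P -/T -egf_pserE rmorphB rmorphD (rmorph_nat (@poly_pser K)).
    by rewrite -/P -/T; ring.
  by rewrite rmorphB rmorphD (rmorph_nat (@poly_pser K)).
- apply: lcoef_ldiv => //.
  change (poly_pser (pol_d 'X t%:P) * pole_part
          = poly_pser (pol_b 'X t%:P)).
  rewrite (rmorph_pol_d (@poly_pser K)) (rmorph_pol_b (@poly_pser K)).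
  rewrite /pol_d (_ : _ * _ = - P ^+ 2 * T * (2 + P - T) * ((2 + P - T) * pole_part)).
    by rewrite pole_partE /pol_b; ring.
  by ring.
Qed.
End LaurentExpression.

(** * Rational functions in [t] *)

Section RationalFunctions.
Variable R : realType.

Lemma ratfun_poly_inj : injective (@ratfun_poly R).
Proof. by move=> p q /eqP; rewrite /ratfun_poly tofrac_eq => /eqP. Qed.

HB.instance Definition _ :=
  GRing.RMorphism.copy (@ratfun_poly R) (@tofrac {poly R}).

Lemma ratfun_nat_neq0 n : (n.+1)%:R != 0 :> ratfun R.
Proof.
rewrite -(rmorph_nat (@ratfun_poly R)) -(rmorph0 (@ratfun_poly R)).
by rewrite (inj_eq ratfun_poly_inj) -polyC_natr polyC_eq0 pnatr_eq0.
Qed.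

Lemma ratfun_2Bt : 2 - @ratfun_poly R 'X = ratfun_poly (2 - 'X).
Proof. by rewrite rmorphB rmorph_nat. Qed.

Lemma two_minus_X_neq0 : 2 - 'X != 0 :> {poly R}.
Proof.
apply/eqP => /(congr1 (fun p : {poly R} => p`_1)) /eqP.
by rewrite -polyC_natr coefB coefC coefX coef0 sub0r oppr_eq0 oner_eq0.
Qed.

Lemma ratfun_2Bt_neq0 : 2 - @ratfun_poly R 'X != 0 :> ratfun R.
Proof.
rewrite ratfun_2Bt -(rmorph0 (@ratfun_poly R)) (inj_eq ratfun_poly_inj).
exact: two_minus_X_neq0.
Qed.

Lemma ratfun_t_neq0 : @ratfun_poly R 'X != 0 :> ratfun R.
Proof.
by rewrite -(rmorph0 (@ratfun_poly R)) (inj_eq ratfun_poly_inj) polyX_eq0.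
Qed.



Lemma egf_integrandE n :
  egf_integrand R n = pcoef (egf_pser (@ratfun_poly R 'X : ratfun R)) n.
Proof. by []. Qed.
End RationalFunctions.

(** * The transfer matrix *)

Section ClosedWalks.
Variables (A : comNzRingType) (Q : finType) (M : Q -> Q -> A).

Definition walk_step (f : Q -> A) (q : Q) : A := \sum_r M q r * f r.

Definition walk_sum (N : nat) (q r : Q) : A :=
  iter N walk_step (fun q' => (q' == r)%:R) q.

Definition walk_series (q r : Q) : pser A := PSer (fun N => walk_sum N q r).

(** The resolvent equation [W = 1 + X M W]. *)
Lemma walk_seriesE q r : walk_series q r = (q == r)%:R +
  poly_pser 'X * \sum_q' poly_pser (M q q')%:P * walk_series q' r.
Proof.
apply: pserP => N; rewrite pcoefD pcoefXM -(rmorph_nat (@poly_pser A)).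
rewrite pcoef_poly -polyC_natr coefC.
case: N => [|N] /=; first by rewrite addr0.
rewrite add0r pcoef_sum; apply: eq_bigr => q' _; by rewrite pcoefCM.
Qed.

Fixpoint path_weight (q : Q) (s : seq Q) : A :=
  if s is r :: s' then M q r * path_weight r s' else 1.

Lemma sum_tuple_cons (n : nat) (F : seq Q -> A) :
  \sum_(s : n.+1.-tuple Q) F s = \sum_q \sum_(s : n.-tuple Q) F (q :: s).
Proof.
rewrite pair_big /=.
rewrite (reindex (fun x : Q * n.-tuple Q => [tuple of x.1 :: x.2])) //=.
exists (fun s : n.+1.-tuple Q => (thead s, behead_tuple s)) => /=.
  by case=> q s _ /=; congr pair; apply: val_inj.
by move=> s _; rewrite [in RHS](tuple_eta s); apply: val_inj.
Qed.

Lemma walk_sumE N q r : walk_sum N q r =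
  \sum_(s : N.-tuple Q) path_weight q s * (last q s == r)%:R.
Proof.
elim: N q => [|N IHN] q.
  rewrite (big_pred1 [tuple]) /= ?mul1r // => s.
  by rewrite [s]tuple0; apply/esym/eqP.
rewrite (@sum_tuple_cons N (fun s => path_weight q s * (last q s == r)%:R)).
rewrite {1}/walk_sum iterS; apply: eq_bigr => q' _.
rewrite -/(walk_sum N q' r) IHN mulr_sumr.
by apply: eq_bigr => s _ /=; rewrite mulrA.
Qed.

Lemma path_weightE q0 q s : path_weight q s =
  \prod_(i < size s) M (nth q0 (q :: s) i) (nth q0 s i).
Proof.
elim: s q => [|r s IHs] q; first by rewrite big_ord0.
by rewrite big_ord_recl /= IHs.
Qed.

(** A walk returning to [q] ends in [q], so only the last entry of [s] contributes, and the path
    closes into a cycle. *)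
Lemma closed_path_weight N (s : N.+1.-tuple Q) :
  \sum_q path_weight q s * (last q s == q)%:R
    = \prod_i M (tnth s (ord_pred i)) (tnth s i).
Proof.
pose q0 := thead s; have lastE q : last q s = tnth s ord_max.
  by rewrite (last_nth q) size_tuple (tnth_nth q).
rewrite (bigD1 (tnth s ord_max)) //= lastE eqxx mulr1 big1 ?addr0; last first.
  by move=> q /negPf qE; rewrite lastE eq_sym qE mulr0.
rewrite (path_weightE q0) size_tuple; apply: eq_bigr => i _.
congr (M _ _); last by rewrite (tnth_nth q0).
case: i => -[|i] iN; rewrite !(tnth_nth q0) /= ?modnDr ?modn_small //.
by rewrite ltnW.
Qed.

(** Length 0 is excluded: there the trace counts the states, but there is a single empty word. *)
Lemma trace_walk_sum N : (0 < N)%N -> \sum_q walk_sum N q q =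
  \sum_(s : {ffun 'I_N -> Q}) \prod_i M (s i) (s (ordS i)).
Proof.
case: N => // N _.
under eq_bigr do rewrite walk_sumE.
rewrite exchange_big; under eq_bigr do rewrite closed_path_weight.
rewrite (reindex (fun s : {ffun 'I_N.+1 -> Q} => [tuple s i | i < N.+1])).
  apply: eq_bigr => s _.
  rewrite (reindex (@ordS N.+1)) /=; last first.
    by apply: onW_bij; exists (@ord_pred N.+1); [apply: ordSK|apply: ord_predK].
  by apply: eq_bigr => i _; rewrite !tnth_mktuple ordSK.
apply: onW_bij; exists (fun u : N.+1.-tuple Q => [ffun i => tnth u i]).
  by move=> s; apply/ffunP => i; rewrite ffunE tnth_mktuple.
by move=> u; apply: eq_from_tnth => i; rewrite tnth_mktuple ffunE.
Qed.
End ClosedWalks.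

(* The state of a seat: the sex of its occupant, whether the previous
   occupant has the same sex, and whether the seat and the next one form a
   marked couple. *)
Definition seat_state : finType := (bool * bool * bool)%type.

Lemma sum_seat_state (V : zmodType) (G : seat_state -> V) :
  \sum_r G r = \sum_(s : bool) \sum_(r : bool) \sum_(o : bool) G (s, r, o).
Proof.
rewrite (pair_bigA _ (fun s r => \sum_(o : bool) G (s, r, o))) /=.
rewrite (pair_bigA _ (fun sr o => G (sr.1, sr.2, o))) /=.
by apply: eq_bigr => -[[s r] o].
Qed.

(** * The determinant of the seat transfer matrix *)

Section Transfer.
Variables (A : comNzRingType) (dl : A).

Definition seat_weight (s : bool) : {poly A} := if s then 'X else 1.

(** Two repeat flags in a row would be three equal sexes, and two marks in a row would be two
    couples sharing a seat. *)
Definition seat_ok (q r : seat_state) : bool :=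
  [&& r.1.2 == (q.1.1 == r.1.1), ~~ (q.1.2 && r.1.2)
    & q.2 ==> (q.1.1 != r.1.1) && ~~ r.2].

Definition transfer (q r : seat_state) : {poly A} :=
  if seat_ok q r then seat_weight r.1.1 * (if r.2 then dl%:P else 1) else 0.

(* [x] marks a man, [y] a woman, and [d] a marked couple; the exponent of
   ['X : pser {poly A}] counts all seats. *)
Local Notation B := (pser {poly A}).
Let y : B := poly_pser 'X.
Let x : B := y * poly_pser ('X)%:P.
Let d : B := poly_pser dl%:P%:P.
Let p : B := x * y.
Let wt (s : bool) : B := if s then x else y.

(** Eliminating the six other states leaves a 2 by 2 system in the states [(s, false, false)], with
    [det_factor s] on the diagonal and [- det_cross s] off it; [transfer_det] is its determinant. *)
Definition det_factor (s : bool) : B := 1 - d * p - d * p * wt s.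
Definition det_cross (s : bool) : B := wt s + p + d * p.
Definition transfer_det : B :=
  det_factor true * det_factor false - det_cross true * det_cross false.

Section Solve.
Variables (b F : seat_state -> B).
Hypothesis FE : forall q, F q = b q + y *
  \sum_r poly_pser (transfer q r)%:P * F r.

Lemma transfer_sum q : y * \sum_r poly_pser (transfer q r)%:P * F r =
  if q.2 then wt (~~ q.1.1) * F (~~ q.1.1, false, false)
  else wt (~~ q.1.1) * (F (~~ q.1.1, false, false) + d * F (~~ q.1.1, false, true))
   + (if q.1.2 then 0 else
        wt q.1.1 * (F (q.1.1, true, false) + d * F (q.1.1, true, true))).
Proof.
rewrite sum_seat_state !big_bool /transfer /seat_ok /=.
case: q => [[[] []] []] /=; rewrite ?rmorph0 ?mulr1 ?polyCM ?rmorphM ?rmorph1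
  /wt /x -/d -/y; ring.
Qed.

Let c (s : bool) : B := b (s, false, false)
  + wt (~~ s) * d * b (~~ s, false, true)
  + wt s * (b (s, true, false) + wt (~~ s) * d * b (~~ s, false, true)
            + d * b (s, true, true)).

(** Cramer's rule for the two equations [E]; [c] gathers the inhomogeneous terms left by the
    elimination. *)
Lemma solve_closed s : transfer_det * F (s, false, false) =
  det_factor (~~ s) * c s + det_cross (~~ s) * c (~~ s).
Proof.
have E s' : det_factor s' * F (s', false, false) =
    det_cross (~~ s') * F (~~ s', false, false) + c s'.
  have := FE (s', false, false); rewrite transfer_sum /=.
  have := FE (s', true, false); rewrite transfer_sum /= => ->.
  have := FE (s', true, true); rewrite transfer_sum /= => ->.
  have := FE (~~ s', false, true); rewrite transfer_sum /= negbK => ->.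
  rewrite /det_factor /det_cross /c => Fs.
  have xy : wt s' * wt (~~ s') = p by case: s' {Fs} => //=; rewrite /p mulrC.
  rewrite (_ : p = wt s' * wt (~~ s')) // [LHS](_ : _ =
    F (s', false, false) - wt s' * wt (~~ s') * d * (1 + wt s') * F (s', false, false)).
    by rewrite {1}Fs; ring.
  by ring.
have D2 : transfer_det
    = det_factor s * det_factor (~~ s) - det_cross s * det_cross (~~ s).
  by rewrite /transfer_det; case: (s) => /=; ring.
rewrite D2 (_ : _ * _ = det_factor (~~ s) * (det_factor s * F (s, false, false))
   - det_cross s * det_cross (~~ s) * F (s, false, false)); last by ring.
rewrite E (_ : _ * (_ + _) = det_cross (~~ s) *
  (det_factor (~~ s) * F (~~ s, false, false)) + det_factor (~~ s) * c s);
  last by ring.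
by rewrite E negbK; ring.
Qed.

Lemma solve_open s r :
  F (s, r, true) = b (s, r, true) + wt (~~ s) * F (~~ s, false, false).
Proof. by rewrite {1}FE transfer_sum. Qed.

Lemma solve_repeat s : F (s, true, false) = b (s, true, false) +
  wt (~~ s) * (F (~~ s, false, false) + d * F (~~ s, false, true)).
Proof. by rewrite {1}FE transfer_sum /= addr0. Qed.

(* Cramer's rule for the eight equations [FE]. *)
Definition solution (q : seat_state) : B :=
  let G s := det_factor (~~ s) * c s + det_cross (~~ s) * c (~~ s) in
  let O s r := transfer_det * b (s, r, true) + wt (~~ s) * G (~~ s) in
  if q.2 then O q.1.1 q.1.2
  else if q.1.2 then transfer_det * b q
    + wt (~~ q.1.1) * (G (~~ q.1.1) + d * O (~~ q.1.1) false)
  else G q.1.1.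

Lemma solutionE q : transfer_det * F q = solution q.
Proof.
have O s r : transfer_det * F (s, r, true) = transfer_det * b (s, r, true)
    + wt (~~ s) * (transfer_det * F (~~ s, false, false)).
  by rewrite solve_open; ring.
case: q => -[s r] [|]; rewrite /solution /=; first by rewrite O solve_closed.
case: r; last exact: solve_closed.
rewrite solve_repeat -solve_closed -[in RHS]solve_closed -O; ring.
Qed.
End Solve.

(** Jacobi's formula for the logarithmic derivative of a determinant, checked on the explicit
    solutions; 8 is the trace of the identity, from the walks of length 0. *)
Lemma trace_transfer :
  (\sum_q walk_series transfer q q - 8) * transfer_det = - theta transfer_det.
Proof.
have tr q : transfer_det * walk_series transfer q q =
    solution (fun r => (r == q)%:R) q.
  by rewrite -(@solutionE _ (fun r => walk_series transfer r q)) // => r;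
    exact: walk_seriesE.
rewrite mulrC mulrBr mulr_sumr; under eq_bigr do rewrite tr.
rewrite sum_seat_state !big_bool /solution /=.
have thx : theta x = x by rewrite thetaM thetaC thetaX mulr0 addr0.
have thy : theta y = y by rewrite thetaX.
have thd : theta d = 0 by rewrite thetaC.
rewrite /transfer_det /det_factor /det_cross /wt /p /=.
move: x y d thx thy thd => x' y' d' thx thy thd.
by rewrite !(thetaD, thetaN, thetaM, theta1, thx, thy, thd); ring.
Qed.
End Transfer.

(** * Sex patterns with marked couples *)

Definition no_triple N (w : {ffun 'I_N -> bool}) : bool :=
  [forall i, ~~ ((w i == w (ordS i)) && (w (ordS i) == w (ordS (ordS i))))].

Definition couple_marking N (w D : {ffun 'I_N -> bool}) : bool :=
  [forall i, D i ==> (w i != w (ordS i)) && ~~ D (ordS i)].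

Section Configurations.
Variables (A : comNzRingType) (dl : A).

Definition config_poly N : {poly A} :=
  \sum_(w : {ffun 'I_N -> bool} | no_triple w)
    \sum_(D : {ffun 'I_N -> bool} | couple_marking w D)
      (dl ^+ #|[set i | D i]|)%:P * 'X^#|[set i | w i]|.

Lemma coef_config_poly N m : (config_poly N)`_m =
  \sum_(w : {ffun 'I_N -> bool} | no_triple w && (#|[set i | w i]| == m))
    \sum_(D : {ffun 'I_N -> bool} | couple_marking w D) dl ^+ #|[set i | D i]|.
Proof.
rewrite /config_poly coef_sum big_mkcondr /=; apply: eq_bigr => w _.
rewrite coef_sum; case: ifPn => wm.
  by apply: eq_bigr => D _; rewrite coefCM coefXn eq_sym wm mulr1.
by rewrite big1 // => D _; rewrite coefCM coefXn eq_sym (negPf wm) mulr0.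
Qed.

Lemma config_poly_eq0 N m : (N < m)%N -> (config_poly N)`_m = 0.
Proof.
move=> Nm; rewrite coef_config_poly big_pred0 // => w.
apply/negbTE/negP => /andP[_ /eqP wm].
by move: (max_card [set i | w i]); rewrite wm card_ord leqNgt Nm.
Qed.

(** Exchanging the sexes preserves the conditions on patterns and markings. *)
Lemma config_poly_sym N m : (m <= N)%N ->
  (config_poly N)`_m = (config_poly N)`_(N - m).
Proof.
move=> mN; rewrite !coef_config_poly.
pose flip (w : {ffun 'I_N -> bool}) := [ffun i => ~~ w i].
have flipK : involutive flip by move=> w; apply/ffunP => i; rewrite !ffunE negbK.
rewrite (reindex_inj (inv_inj flipK)) /=; apply: eq_big => w.
  congr (_ && _).
    apply: eq_forallb => i; rewrite !ffunE.
    by case: (w i); case: (w (ordS i)); case: (w (ordS (ordS i))).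
  have -> : [set i | flip w i] = ~: [set i | w i].
    by apply/setP => i; rewrite !inE ffunE.
  have := cardsC [set i | w i]; rewrite card_ord.
  move: #|[set i | w i]| #|~: _| => a b abN.
  by apply/eqP/eqP; lia.
move=> _; apply: eq_bigl => D; apply: eq_forallb => i; rewrite !ffunE.
by case: (w i); case: (w (ordS i)).
Qed.

(** A closed word of states consists of a pattern, a marking and repeat flags, and the pattern
    forces the flags. *)
Lemma sum_closed_transfer N :
  \sum_(s : {ffun 'I_N -> seat_state}) \prod_i transfer dl (s i) (s (ordS i))
    = config_poly N.
Proof.
pose mk (x : {ffun 'I_N -> bool} * {ffun 'I_N -> bool} * {ffun 'I_N -> bool}) :=
  [ffun i => (x.1.1 i, x.2 i, x.1.2 i)] : {ffun 'I_N -> seat_state}.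
have mk_bij : bijective mk.
  exists (fun s : {ffun 'I_N -> seat_state} =>
    ([ffun i => (s i).1.1] : {ffun 'I_N -> bool},
     [ffun i => (s i).2] : {ffun 'I_N -> bool},
     [ffun i => (s i).1.2] : {ffun 'I_N -> bool})).
    by move=> [[w D] r]; rewrite /mk; congr (_, _, _); apply/ffunP => i; rewrite !ffunE.
  by move=> s; apply/ffunP => i; rewrite !ffunE; case: (s i) => -[].
rewrite (reindex mk) /=; last exact: onW_bij.
rewrite -(pair_bigA _ (fun x r =>
  \prod_i transfer dl (mk (x, r) i) (mk (x, r) (ordS i)))) /=.
rewrite -(pair_bigA _ (fun w D =>
  \sum_r \prod_i transfer dl (mk (w, D, r) i) (mk (w, D, r) (ordS i)))) /=.
rewrite /config_poly [RHS]big_mkcond /=; apply: eq_bigr => w _.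
transitivity (\sum_(D : {ffun 'I_N -> bool} | no_triple w && couple_marking w D)
      (dl ^+ #|[set i | D i]|)%:P * 'X^#|[set i | w i]|); last first.
  by case: (no_triple w) => //=; rewrite big_pred0_eq.
rewrite [RHS]big_mkcond /=; apply: eq_bigr => D _.
(* The only flags that can give a non-zero product. *)
pose r0 : {ffun 'I_N -> bool} := [ffun i => w (ord_pred i) == w i].
rewrite (bigD1 r0) //= [X in _ + X]big1 ?addr0; last first.
  move=> r /eqP rr0; have /existsP[i ri] : [exists i, r i != r0 i].
    rewrite -negb_forall; apply/negP => /forallP re; apply: rr0.
    by apply/ffunP => i; apply/eqP.
  rewrite (bigD1 (ord_pred i)) //= /transfer /seat_ok !ffunE /= ord_predK.
  by move: ri; rewrite ffunE => /negPf ->; rewrite mul0r.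
have okE i : seat_ok (mk (w, D, r0) i) (mk (w, D, r0) (ordS i)) =
   ~~ ((w (ord_pred i) == w i) && (w i == w (ordS i)))
   && (D i ==> (w i != w (ordS i)) && ~~ D (ordS i)).
  by rewrite /seat_ok !ffunE /= ordSK eqxx.
have [/andP[/forallP wP /forallP DP]|wD] := ifPn.
  transitivity (\prod_i (seat_weight A (w (ordS i)) * (if D (ordS i) then dl%:P else 1))).
    apply: eq_bigr => i _; rewrite /transfer okE DP andbT.
    by have := wP (ord_pred i); rewrite ord_predK => ->; rewrite !ffunE.
  rewrite -(reindex (@ordS N) (P := xpredT)
    (F := fun i => seat_weight A (w i) * (if D i then dl%:P else 1))) /=;
    last by apply: onW_bij; exists (@ord_pred N); [apply: ordSK|apply: ord_predK].
  rewrite big_split mulrC -!big_mkcond /=; congr (_ * _).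
    by rewrite prodr_const cardsE.
  by rewrite prodr_const polyC_exp cardsE.
have [i iF] : exists i, ~~ seat_ok (mk (w, D, r0) i) (mk (w, D, r0) (ordS i)).
  move: wD; rewrite negb_and => /orP[]; rewrite negb_forall => /existsP[i].
    rewrite negbK => wi; exists (ordS i); rewrite okE ordSK.
    by case/andP: wi => -> ->.
  by move=> Di; exists i; rewrite okE (negPf Di) andbF.
by rewrite (bigD1 i) //= /transfer (negPf iF) mul0r.
Qed.

(** The constant term is 0, as in any Euler derivative, whereas [config_poly] at 0 is 1. *)
Definition config_series : pser {poly A} :=
  PSer (fun N => if N is 0 then 0 else config_poly N).

Lemma config_seriesE : config_series * transfer_det dl = - theta (transfer_det dl).
Proof.
rewrite -trace_transfer; congr (_ * _); apply: pserP => -[|N]; last first.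
  rewrite pcoefB pcoef_sum -(rmorph_nat (@poly_pser {poly A})) pcoef_poly.
  by rewrite -polyC_natr coefC subr0 trace_walk_sum // sum_closed_transfer.
rewrite pcoefB pcoef_sum -(rmorph_nat (@poly_pser {poly A})) pcoef_poly.
by rewrite -polyC_natr coefC sum_seat_state !big_bool /=; ring.
Qed.
End Configurations.

(** * Strips with a fixed excess of men over women *)

Section StripCoefficients.
Variables (K : fieldType) (t : K).
Hypothesis t_neq0 : t != 0.

(* With [x] and [y] marking men and women and [p = x y], the coefficient of
   [x^k] in a series in [x] and [y] is a series in [p], scaled by [p -> t p]. *)
Definition strip_coef (k : nat) (F : pser {poly K}) : pser K :=
  PSer (fun n => t ^+ n * (pcoef F (2 * n + k)%N)`_(n + k)).

Lemma pcoef_strip k F n :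
  pcoef (strip_coef k F) n = t ^+ n * (pcoef F (2 * n + k)%N)`_(n + k).
Proof. by []. Qed.

(** Holds for series in [x] and [y]: a monomial of degree [N] has at most [N] factors [x]. *)
Definition bounded (F : pser {poly K}) : Prop :=
  forall N m, (N < m)%N -> (pcoef F N)`_m = 0.

(** Invariance under exchanging [x] and [y], by which strip 1 stands for strip -1. *)
Definition symmetric (F : pser {poly K}) : Prop :=
  forall N m, (m <= N)%N -> (pcoef F N)`_m = (pcoef F N)`_(N - m).

Local Notation B := (pser {poly K}).
Let y : B := poly_pser 'X.
Let x : B := y * poly_pser ('X)%:P.
Let dl : K := - t^-1.
Let d : B := poly_pser dl%:P%:P.
Let p : B := x * y.
Let P : pser K := poly_pser 'X.
Let T : pser K := poly_pser t%:P.
Let Dl : pser K := poly_pser dl%:P.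

Lemma strip_coefD k (F G : B) :
  strip_coef k (F + G) = strip_coef k F + strip_coef k G.
Proof. by apply: pserP => n; rewrite /= coefD mulrDr. Qed.

Lemma strip_coefN k (F : B) : strip_coef k (- F) = - strip_coef k F.
Proof. by apply: pserP => n; rewrite /= coefN mulrN. Qed.

Lemma strip_coef_theta k (F : B) :
  strip_coef k (theta F) = 2 * theta (strip_coef k F) + k%:R * strip_coef k F.
Proof.
apply: pserP => n; rewrite pcoefD -!(rmorph_nat (@poly_pser K)).
rewrite -!polyC_natr !pcoefCM /= coefMn mulrnAr mulrnDr.
by rewrite (mulr_natl _ 2) (mulr_natl _ k) -mulrnA mulnC.
Qed.

Lemma pcoef_xM (F : B) N :
  pcoef (x * F) N = if N is M.+1 then 'X * pcoef F M else 0.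
Proof.
rewrite /x -mulrA pcoefXM; case: N => // N; exact: pcoefCM.
Qed.

Lemma pcoef_yM (F : B) N :
  pcoef (y * F) N = if N is M.+1 then pcoef F M else 0.
Proof. exact: pcoefXM. Qed.

Lemma bounded_xM F : bounded F -> bounded (x * F).
Proof.
move=> bF [|N] m; rewrite pcoef_xM ?coef0 // coefXM => Nm.
by case: m Nm => // m Nm; rewrite bF.
Qed.

Lemma bounded_yM F : bounded F -> bounded (y * F).
Proof.
move=> bF [|N] m; rewrite pcoef_yM ?coef0 // => Nm.
by rewrite bF // ltnW.
Qed.

Lemma bounded_pM F : bounded F -> bounded (p * F).
Proof. by move=> bF; rewrite /p -mulrA; apply/bounded_xM/bounded_yM. Qed.

Lemma bounded_dM F : bounded F -> bounded (d * F).
Proof. by move=> bF N m Nm; rewrite pcoefCM coefCM bF ?mulr0. Qed.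

Lemma strip_coef_dM k F : strip_coef k (d * F) = Dl * strip_coef k F.
Proof. by apply: pserP => n; rewrite pcoefCM !pcoef_strip pcoefCM coefCM mulrCA. Qed.

(** [y x^(k+1) = p x^k], and the rescaling turns [p] into [t p]. *)
Lemma strip_coef_yM k F : bounded F ->
  strip_coef k (y * F) = T * P * strip_coef k.+1 F.
Proof.
move=> bF; apply: pserP => n; rewrite -mulrA pcoefCM pcoefXM pcoef_strip pcoef_yM.
case: n => [|n].
  (* A monomial without [y] does not occur in [y * F]. *)
  by rewrite muln0 !add0n; case: k => [|k]; rewrite ?coef0 ?bF ?mulr0.
rewrite (_ : (2 * n.+1 + k = (2 * n + k.+1).+1)%N); last by lia.
by rewrite pcoef_strip exprS mulrA addSnnS.
Qed.

Lemma strip_coef_xM k F : strip_coef k.+1 (x * F) = strip_coef k F.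
Proof.
by apply: pserP => n; rewrite !pcoef_strip addnS pcoef_xM coefXM addnS.
Qed.

(** Multiplication by [x] reaches strip 0 from strip -1, which symmetry identifies with strip 1. *)
Lemma strip_coef0_xM F : symmetric F ->
  strip_coef 0 (x * F) = T * P * strip_coef 1 F.
Proof.
move=> sF; apply: pserP => n; rewrite -mulrA pcoefCM pcoefXM pcoef_strip pcoef_xM.
case: n => [|n]; first by rewrite muln0 addn0 coef0 !mulr0.
rewrite (_ : (2 * n.+1 + 0 = (2 * n + 1).+1)%N); last by lia.
rewrite coefXM addn0 pcoef_strip exprS mulrA sF; last by lia.
by congr (_ * _`_ _); lia.
Qed.

Lemma strip_coef_pM k F : bounded F ->
  strip_coef k (p * F) = T * P * strip_coef k F.
Proof.
move=> bF; rewrite (_ : p * F = y * (x * F)); last by rewrite /p; ring.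
by rewrite strip_coef_yM ?strip_coef_xM //; exact: bounded_xM.
Qed.

Let TD : T * Dl = -1.
Proof. by rewrite -rmorphM -polyCM /dl mulrN divff // !rmorphN !rmorph1. Qed.

(** The rescaling by [t] absorbs the weight [- 1 / t] of a mark. *)
Lemma strip_coef_dpM k F : bounded F ->
  strip_coef k (d * (p * F)) = - P * strip_coef k F.
Proof.
move=> bF; rewrite strip_coef_dM strip_coef_pM // (_ : - P = T * Dl * P).
  by ring.
by rewrite TD mulN1r.
Qed.

(** On strips the determinant acts as [A + C x + C y]: [x] raises the index by one, [y] lowers it
    with a factor [t p], and at [k = 0] strip -1 is folded onto strip 1. *)
Lemma strip_coef_transfer k F : bounded F -> symmetric F ->
  strip_coef k (transfer_det dl * F) =
  strip_diag P T * strip_coef k F + strip_off P T *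
   ((if k is j.+1 then strip_coef j F else T * P * strip_coef 1 F)
    + T * P * strip_coef k.+1 F).
Proof.
move=> bF sF.
have bx := bounded_xM bF; have by' := bounded_yM bF.
have sub G H : strip_coef k (G - H) = strip_coef k G - strip_coef k H.
  by rewrite strip_coefD strip_coefN.
have dbl (G : B) : 2 * G = G + G by rewrite mulr_natl.
pose dp G := d * (p * G).
have bdp G : bounded G -> bounded (dp G).
  by move=> bG; apply/bounded_dM/bounded_pM.
have dpE G : bounded G -> strip_coef k (dp G) = - P * strip_coef k G.
  exact: strip_coef_dpM.
(* The determinant expands as [diag + off x + off y]; replacing [p] by [T P] and [d p] by [- P]
   yields [strip_diag] and [strip_off]. *)
pose diag G := G - p * G - 2 * dp G - p * (p * G) - 2 * dp (p * G)
  + dp (dp (p * G)).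
pose off G := - (p * G) - 2 * dp G + dp (dp G).
have offE G : bounded G -> strip_coef k (off G) = strip_off P T * strip_coef k G.
  move=> bG; have bdpG := bdp _ bG.
  rewrite /off !(sub, strip_coefD, strip_coefN, dbl) !dpE // strip_coef_pM //.
  by rewrite /strip_off; ring.
have diagE G : bounded G -> strip_coef k (diag G) = strip_diag P T * strip_coef k G.
  move=> bG; have bpG := bounded_pM bG; have bdpG := bdp _ bpG.
  rewrite /diag !(sub, strip_coefD, strip_coefN, dbl) !dpE // !strip_coef_pM //.
  by rewrite /strip_diag; ring.
rewrite (_ : transfer_det dl * F = diag F + (off (x * F) + off (y * F))); last first.
  have -> : transfer_det dl = (1 - d * p - d * p * x) * (1 - d * p - d * p * y)
    - (x + p + d * p) * (y + p + d * p) by [].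
  by rewrite /diag /off /dp /p; ring.
rewrite (strip_coefD _ (diag F)) (strip_coefD _ (off _)) diagE // !offE //.
rewrite strip_coef_yM // -mulrDr.
congr (_ + _ * (_ + _)).
by case: (k) => [|j]; rewrite ?strip_coef_xM ?strip_coef0_xM.
Qed.

Lemma config_series_bounded : bounded (config_series dl).
Proof. by move=> [|N] m Nm; rewrite /= ?coef0 ?config_poly_eq0. Qed.

Lemma config_series_symmetric : symmetric (config_series dl).
Proof. by move=> [|N] m mN; rewrite /= ?coef0 1?config_poly_sym. Qed.

Lemma bounded1 : bounded (1 : B).
Proof. by move=> [|N] [|m]; rewrite // pcoef1 ?coef1 ?coef0. Qed.

Lemma symmetric1 : symmetric (1 : B).
Proof. by move=> [|N] [|m]; rewrite // pcoef1 ?coef1 ?coef0. Qed.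

Lemma strip_coef1 k : strip_coef k (1 : B) = (k == 0%N)%:R.
Proof.
apply: pserP => n; rewrite pcoef_strip pcoef1 -polyC_natr coefC.
rewrite -(rmorph_nat (@poly_pser K)) pcoef_poly -polyC_natr coefC.
by case: n k => [|n] [|k]; rewrite ?mulnS /= ?mul1r ?mulr0 ?mulr1n.
Qed.

Local Notation D := (transfer_det dl).
Local Notation Z := (config_series dl).

Lemma strip_coef_det k : strip_coef k D = strip_diag P T * (k == 0%N)%:R
    + strip_off P T * (k == 1%N)%:R.
Proof.
rewrite -[D]mulr1 strip_coef_transfer ?strip_coef1; [|exact: bounded1|exact: symmetric1].
by case: k => [|k]; rewrite ?strip_coef1 ?eqSS /=; ring.
Qed.

Lemma config_strip k : strip_diag P T * strip_coef k Z + strip_off P T *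
   ((if k is j.+1 then strip_coef j Z else T * P * strip_coef 1 Z)
    + T * P * strip_coef k.+1 Z) =
  - (2 * theta (strip_coef k D) + k%:R * strip_coef k D).
Proof.
rewrite -strip_coef_transfer.
- by rewrite mulrC config_seriesE strip_coefN strip_coef_theta.
- exact: config_series_bounded.
- exact: config_series_symmetric.
Qed.

Lemma config_strip0 : strip_diag P T * strip_coef 0 Z
  + 2 * (T * P) * strip_off P T * strip_coef 1 Z = - 2 * theta (strip_diag P T).
Proof.
have := config_strip 0; rewrite strip_coef_det.
by rewrite /= !mulr1 mulr0 addr0 mul0r addr0 => E; rewrite mulNr -E; ring.
Qed.

(** Modulo [p^2] the relation of strip 0 reduces to [Z = - 2 theta A], since [Z] has no constant
    term there and the term in strip 1 is divisible by [p^2]. *)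
Lemma config_strip_coef1 : pcoef (strip_coef 0 Z) 1 = - 2 * (2 - t).
Proof.
pose A' : pser K := (2 - T) + T * P * (2 + P - T).
have AE : strip_diag P T = 1 + P * A' by rewrite /strip_diag /A'; ring.
have Z00 : pcoef (strip_coef 0 Z) 0 = 0 by rewrite pcoef_strip coef0 mulr0.
have E : strip_coef 0 Z = P * (- 2 * A' - 2 * theta A' - A' * strip_coef 0 Z
    - P * (2 * T * (2 + P - T) * strip_coef 1 Z)).
  have := config_strip0; rewrite AE thetaD theta1 thetaM thetaX.
  move=> /(congr1 (fun f => f - P * (A' * strip_coef 0 Z)
    - 2 * (T * P) * strip_off P T * strip_coef 1 Z)) E.
  apply: etrans (etrans E _); last by rewrite /strip_off; ring.
  by ring.
have A'0 : pcoef A' 0 = 2 - t.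
  rewrite pcoefD -(mulrA T) pcoefCM pcoefXM mulr0 addr0 pcoefB.
  by rewrite -(rmorph_nat (@poly_pser K)) !pcoef_poly -polyC_natr !coefC.
have X1 (f : pser K) : pcoef (P * f) 1 = pcoef f 0 by rewrite pcoefXM.
have X0 (f : pser K) : pcoef (P * f) 0 = 0 by rewrite pcoefXM.
rewrite E X1 !pcoefB X0 subr0.
rewrite (pcoefM0 A') Z00 mulr0 subr0 -(rmorph_nat (@poly_pser K) 2) -rmorphN.
rewrite -polyC_natr -polyCN !pcoefCM A'0 /= mulr0n mulr0 subr0; ring.
Qed.

Lemma config_strip_closed_form (J H : pser K) : 2 != 0 :> K -> 2 - t != 0 ->
  (2 + P - T) * J = P - 3 * T + 6 ->
  (T - (P + 2)) * egf_sqrt t * H = egf_num P T ->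
  strip_coef 0 Z = - 6 + J + H.
Proof.
move=> two t2 JE HE.
apply: (@strip_closed_form _ t two t2 (fun k => strip_coef k Z)) JE HE => [||k].
- exact: config_strip0.
- have := config_strip 1; rewrite strip_coef_det.
  by rewrite /= !mulr1 mulr0 add0r mul1r => <-; ring.
- have := config_strip k.+2; rewrite strip_coef_det.
  by rewrite /= !mulr0 addr0 theta0 !mulr0 addr0 oppr0 => <-; ring.
Qed.
End StripCoefficients.

(** * Inclusion-exclusion over adjacent couples *)

Section Extensions.
Variables (I rT : finType).

Definition extensions (g : {ffun I -> rT}) (E B : {set I}) :
    {set {ffun I -> rT}} :=
  [set f : {ffun I -> rT} | [forall i in ~: B, f i == g i] & dinjectiveb f (E :|: B)].

(** Induction on [B]: one of its points takes any value outside the image of [E], then joins [E]. *)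
Lemma card_extensions (g : {ffun I -> rT}) (E B : {set I}) :
  [disjoint E & B] -> {in E &, injective g} ->
  #|extensions g E B| = ((#|rT| - #|E|) ^_ #|B|)%N.
Proof.
move m_eq : #|B| => m; elim: m => [|m IHm] in g E B m_eq *.
  move/eqP: m_eq; rewrite cards_eq0 => /eqP -> _ gI; rewrite ffactn0.
  rewrite (_ : extensions _ _ _ = [set g]) ?cards1 //.
  apply/setP => f; rewrite !inE finset.setU0; apply/idP/eqP => [/andP[/forallP fg _]|->].
    by apply/ffunP => i; have := fg i; rewrite !inE => /eqP.
  by apply/andP; split; [apply/forall_inP => i _|apply/dinjectiveP].
move=> EB gI; have [b bB] : exists b, b \in B by apply/card_gt0P; rewrite m_eq.
have bE : b \notin E by move: EB; rewrite disjoint_sym => /disjointFr ->.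
rewrite ffactnS -sum1_card (partition_big (fun f : {ffun I -> rT} => f b) predT) //=.
pose upd c : {ffun I -> rT} := [ffun i => if i == b then c else g i].
have EbB : (b |: E) :|: (B :\ b) = E :|: B.
  by rewrite finset.setUAC finset.setD1K // finset.setUC.
have cb c : \sum_(f in extensions g E B | f b == c) 1 =
    if c \in [set g i | i in E] then 0%N else ((#|rT| - #|E|).-1 ^_ m)%N.
  rewrite sum1dep_card; case: ifPn => [/imsetP[i iE cE]|cE].
    apply: eq_card0 => f; rewrite !inE; apply/negP => /andP[/andP[/forall_inP fg]].
    move=> /dinjectiveP fI /eqP fb; have ib : i != b by apply: contraTneq iE => ->.
    case/eqP: ib; apply: fI; rewrite ?inE ?iE ?bB ?orbT // fb cE.
    by apply/eqP/fg; rewrite inE (disjointFr EB).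
  transitivity #|extensions (upd c) (b |: E) (B :\ b)|.
    apply: eq_card => f; rewrite !inE EbB.
    apply/andP/andP => [[/andP[/forall_inP fg fI] /eqP fb]|].
      split=> //; apply/forall_inP => i; rewrite !inE ffunE negb_and negbK.
      by case: eqVneq => [->|_ /= iB]; rewrite ?fb // fg // inE.
    case=> /forall_inP fg fI; split.
      rewrite fI andbT; apply/forall_inP => i; rewrite inE => iB.
      have := fg i; rewrite !inE ffunE (negPf iB) andbF => /(_ isT).
      have ib : i != b by apply: contraNneq iB => ->.
      by rewrite (negPf ib) => /eqP ->.
    by have := fg b; rewrite !inE ffunE eqxx => /(_ isT).
  rewrite IHm ?cardsU1 ?bE //.
  - by congr (_ ^_ _)%N; lia.
  - by have := cardsD1 b B; rewrite bB m_eq => -[].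
  - apply/pred0P => j /=; rewrite !inE; case: (eqVneq j b) => //= _.
    by move/pred0P: EB => /(_ j).
  move=> i j; rewrite !inE !ffunE.
  case: (eqVneq i b) => [->|ib] /=; case: (eqVneq j b) => [->|jb] //=.
  - by move=> _ jE cg; case/negP: cE; apply/imsetP; exists j.
  - by move=> iE _ cg; case/negP: cE; apply/imsetP; exists i.
  - exact: gI.
under eq_bigr do rewrite cb.
rewrite (bigID (mem [set g i | i in E])) /= big1 ?add0n; last by move=> c ->.
rewrite (eq_bigr (fun=> ((#|rT| - #|E|).-1 ^_ m)%N)); last by move=> c /negPf ->.
rewrite sum_nat_const; congr (_ * _)%N.
have := cardC (mem [set g i | i in E]); rewrite card_in_imset // => <-.
rewrite addKn; exact: eq_card.
Qed.
End Extensions.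

(** * Labelings of the seats by couples *)

Lemma ordS_neq N (i : 'I_N) : (1 < N)%N -> ordS i != i.
Proof.
move=> N1; apply/eqP => /(congr1 val) /=; have := ltn_ord i.
have [iN _|iN iN'] := ltnP i.+1 N; first by rewrite modn_small //; lia.
by rewrite (_ : i.+1 = N) ?modnn; lia.
Qed.

Lemma ordSS_neq N (i : 'I_N) : (2 < N)%N -> ordS (ordS i) != i.
Proof.
move=> N2; apply/eqP => /(congr1 val) /=; have := ltn_ord i.
have [iN _|iN iN'] := ltnP i.+1 N.
  rewrite (modn_small iN); have [iN2|iN2] := ltnP i.+2 N.
    by rewrite modn_small //; lia.
  by rewrite (_ : i.+2 = N) ?modnn; lia.
by rewrite (_ : i.+1 = N) ?modnn ?modn_small; lia.
Qed.

Section Labelings.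
Variables (n : nat) (w D : {ffun 'I_(2 * n) -> bool}).
Hypothesis n1 : (1 < n)%N.
Local Notation seat := 'I_(2 * n).
Implicit Types (f g h : {ffun seat -> 'I_n}) (i j : seat).

(** The sexes [w] are given and [f] names the couple at each seat; a mark makes spouses of a seat
    and the next. *)
Definition labelings : {set {ffun seat -> 'I_n}} :=
  [set f : {ffun seat -> 'I_n} |
    [&& dinjectiveb f [set i | w i], dinjectiveb f [set i | ~~ w i]
      & [forall i, D i ==> (f i == f (ordS i))]]].

Let N1 : (1 < 2 * n)%N. Proof. lia. Qed.
Let N2 : (2 < 2 * n)%N. Proof. lia. Qed.

Lemma labelings_inj f i j : f \in labelings -> w i = w j -> f i = f j -> i = j.
Proof.
rewrite inE => /and3P[/dinjectiveP fm /dinjectiveP fw _] wij fij.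
by case wi: (w i) (wij) => /esym wj; [apply: fm|apply: fw]; rewrite // inE ?wi ?wj.
Qed.

(** By injectivity each sex takes at most [n] of the [2 n] seats. *)
Lemma labelings_balanced f : f \in labelings -> #|[set i | w i]| = n.
Proof.
rewrite inE => /and3P[/dinjectiveP fm /dinjectiveP fw _].
have cn (S : {set seat}) : {in S &, injective f} -> (#|S| <= n)%N.
  by move=> fS; rewrite -(card_in_imset fS) -[X in (_ <= X)%N]card_ord max_card.
have := cn _ fm; have := cn _ fw; have := cardsC [set i | w i].
rewrite card_ord (_ : ~: _ = [set i | ~~ w i]); last first.
  by apply/setP => i; rewrite !inE.
by move: #|_| #|_|; lia.
Qed.

(** A marked pair of one sex would seat a person twice; so would overlapping marks, at the seats [i]
    and [i + 2], which differ because [2 n > 2]. *)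
Lemma labelings_marking f : f \in labelings -> couple_marking w D.
Proof.
move=> fL; have fD i : D i -> f i = f (ordS i).
  by move: fL; rewrite inE => /and3P[_ _ /forallP/(_ i)/implyP fi] /fi/eqP.
have wS i : D i -> w i != w (ordS i).
  move=> Di; apply/eqP => wi; have := labelings_inj fL wi (fD _ Di).
  by move/esym/eqP; rewrite (negPf (ordS_neq i N1)).
apply/forallP => i; apply/implyP => Di; rewrite wS //=; apply/negP => DSi.
have wi : w i = w (ordS (ordS i)).
  by have := wS _ Di; have := wS _ DSi; do 3 case: (w _).
have := labelings_inj fL wi; rewrite fD // fD // => /(_ erefl)/esym/eqP.
by rewrite (negPf (ordSS_neq i N2)).
Qed.

Section Marked.
Hypotheses (wn : #|[set i | w i]| = n) (wD : couple_marking w D).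

Let D_alt i : D i -> w (ordS i) = ~~ w i.
Proof.
by move/forallP/(_ i)/implyP: wD => wDi /wDi/andP[]; do 2 case: (w _).
Qed.
Let D_next i : D i -> D (ordS i) = false.
Proof.
by move/forallP/(_ i)/implyP: wD => wDi /wDi/andP[_ /negPf].
Qed.

Definition covered i := D i || D (ord_pred i).
Definition partner i := if D i then ordS i else ord_pred i.

Lemma partner_sex i : covered i -> w (partner i) = ~~ w i.
Proof.
rewrite /covered /partner; case: ifP => [/D_alt //|_ /= Di].
by have := D_alt Di; rewrite ord_predK => ->; rewrite negbK.
Qed.

Lemma partnerK i : covered i -> partner (partner i) = i.
Proof.
rewrite /covered /partner; case Di: (D i) => /= Dp.
  by rewrite D_next // ordSK.
by rewrite Dp ord_predK.
Qed.

(** Marked pairs are disjoint and contain one woman each. *)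
Lemma card_covered_women : #|[set i | ~~ w i && covered i]| = #|[set i | D i]|.
Proof.
pose wom i := if w i then ordS i else i.
have womI : {in [set i | D i] &, injective wom}.
  move=> i j; rewrite !inE /wom => Di Dj.
  case: (w i); case: (w j) => //.
  - by move/(can_inj (@ordSK _)).
  - by move=> ij; move: Dj; rewrite -ij D_next.
  - by move=> ij; move: Di; rewrite ij D_next.
rewrite -(card_in_imset womI); apply: eq_card => j; rewrite inE.
apply/andP/imsetP => [[wj]|[i]].
  rewrite /covered; case: (boolP (D j)) => [Dj _|_ /= Dj].
    by exists j; rewrite ?inE // /wom (negPf wj).
  exists (ord_pred j); rewrite ?inE // /wom ord_predK.
  by have := D_alt Dj; rewrite ord_predK (negPf wj); case: (w _).
rewrite inE /wom => Di ->; case: ifP => wi.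
  by rewrite D_alt // wi /covered ordSK Di orbT.
by rewrite wi /covered Di.
Qed.

(** The men are seated in [n!] ways; this forces the women in marked pairs, and the other [n - |D|]
    women come in any order. *)
Lemma card_marked_labelings :
  #|labelings| = (n`! * (n - #|[set i | D i]|)`!)%N.
Proof.
have n0 : (0 < n)%N by lia.
pose c0 := Ordinal n0.
pose men := [set i | w i]; pose women := [set i | ~~ w i].
pose E := [set i | ~~ w i && covered i].
pose free := [set i | ~~ w i && ~~ covered i].
have EF : E :|: free = women.
  by apply/setP => i; rewrite !inE; case: (w i); case: covered.
(* [c0] is a mere filler on the women's seats, making the men's part an extension of a constant
   map. *)
pose menpart f := [ffun i => if w i then f i else c0] : {ffun seat -> 'I_n}.
pose H1 := extensions [ffun=> c0] finset.set0 men.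
have cH1 : #|H1| = n`!.
  rewrite card_extensions; first by rewrite cards0 subn0 card_ord wn ffactnn.
  - by apply/pred0P => i; rewrite /= !inE.
  - by move=> i j; rewrite inE.
have menH1 f : f \in labelings -> menpart f \in H1.
  rewrite !inE => /and3P[/dinjectiveP fm _ _]; apply/andP; split.
    by apply/forall_inP => i; rewrite !inE !ffunE => /negPf ->.
  apply/dinjectiveP => i j; rewrite !inE /= !ffunE => wi wj.
  by rewrite wi wj => ?; apply: fm; rewrite // inE.
rewrite -sum1_card (partition_big menpart (mem H1)) //= -cH1.
rewrite -sum_nat_const; apply: eq_bigr => h.
rewrite !inE => /andP[/forall_inP hc /dinjectiveP hI].
rewrite sum1dep_card.
(* The values forced by the men [h]; [c0] fills the seats still free. *)
pose g : {ffun seat -> 'I_n} :=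
  [ffun i => if w i then h i else if covered i then h (partner i) else c0].
have gI : {in E &, injective g}.
  move=> i j; rewrite !inE !ffunE => /andP[wi ci] /andP[wj cj].
  rewrite (negPf wi) (negPf wj) ci cj => hij.
  have : partner i = partner j.
    by apply: hI; rewrite // !inE /= partner_sex // ?wi ?wj.
  by move/(congr1 partner); rewrite !partnerK.
transitivity #|extensions g E free|.
  apply: eq_card => f; rewrite !inE EF.
  apply/andP/andP => [[/and3P[/dinjectiveP fm fw /forallP fD] /eqP fh]|].
    split=> //; apply/forall_inP => i; rewrite !inE ffunE -fh !ffunE.
    case: (boolP (w i)) => //= wi; rewrite negbK => ci.
    rewrite ci partner_sex // wi.
    move: ci; rewrite /covered /partner; case: ifP => [Di _|_ /= Di].
      by have := fD i; rewrite Di.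
    by have := fD (ord_pred i); rewrite Di ord_predK eq_sym.
  case=> /forall_inP fg fw.
  have fman i : w i -> f i = h i.
    by move=> wi; have := fg i; rewrite !inE ffunE wi /= => /(_ isT)/eqP.
  have fwom i : ~~ w i -> covered i -> f i = h (partner i).
    move=> wi ci; have := fg i; rewrite !inE ffunE (negPf wi) ci /=.
    by move=> /(_ isT)/eqP.
  split; last first.
    apply/eqP/ffunP => i; rewrite ffunE; case: ifP => [/fman //|wi].
    by have := hc i; rewrite !inE wi ffunE => /(_ isT)/eqP.
  apply/and3P; split => //.
    apply/dinjectiveP => i j; rewrite !inE => wi wj.
    by rewrite !fman // => hij; apply: hI; rewrite // !inE.
  apply/forallP => i; apply/implyP => Di; apply/eqP.
  have cSi : covered (ordS i) by rewrite /covered ordSK Di orbT.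
  have ci : covered i by rewrite /covered Di.
  case: (boolP (w i)) => wi.
    rewrite fman // fwom ?D_alt ?wi //.
    by rewrite /partner D_next // ordSK.
  by rewrite fwom // fman ?D_alt // /partner Di.
rewrite card_extensions //; last first.
  by apply/pred0P => i; rewrite /= !inE; case: (w i); case: covered.
rewrite card_ord card_covered_women (_ : #|free| = n - #|[set i | D i]|)%N.
  by rewrite ffactnn.
have := cardsC men; rewrite card_ord wn (_ : ~: men = women); last first.
  by apply/setP => i; rewrite !inE.
have := cardsUI E free; rewrite EF card_covered_women.
rewrite (_ : E :&: free = finset.set0) ?cards0; last first.
  by apply/setP => i; rewrite !inE; case: (w i); case: covered.
by move: #|free| #|women| #|[set i | D i]|; lia.
Qed.
End Marked.

Lemma card_labelings : #|labelings| =
  if (#|[set i | w i]| == n) && couple_marking w D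
  then (n`! * (n - #|[set i | D i]|)`!)%N else 0%N.
Proof.
case: ifPn => [/andP[/eqP wn wD]|]; first exact: card_marked_labelings.
apply: contraNeq; rewrite cards_eq0 => /set0Pn[f fL].
by rewrite (labelings_balanced fL) eqxx (labelings_marking fL).
Qed.
End Labelings.

(** * Inclusion-exclusion for admissible seatings *)

Lemma prod_sub_indicator (R : comNzRingType) (I : finType) (e : I -> bool) :
  \prod_i (1 - (e i)%:R) = \sum_(D : {ffun I -> bool})
    (-1) ^+ #|[set i | D i]| * [forall i, D i ==> e i]%:R :> R.
Proof.
transitivity (\prod_i \sum_(b : bool) (if b then - (e i)%:R else 1) : R).
  by apply: eq_bigr => i _; rewrite big_bool addrC.
rewrite bigA_distr_bigA; apply: eq_bigr => D _.
transitivity (\prod_i ((if D i then -1 else 1) * (D i ==> e i)%:R) : R).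
  by apply: eq_bigr => i _; case: (D i); rewrite /= ?mul1r ?mulN1r.
rewrite big_split -big_mkcond prodr_const cardsE; congr (_ * _).
case: (boolP [forall i, _]) => [/forallP De|].
  by rewrite big1 // => i _; rewrite De.
by rewrite negb_forall => /existsP[i /negPf ei]; rewrite (bigD1 i) //= ei mul0r.
Qed.

Definition seat_pairs n (x : {ffun 'I_(2 * n) -> bool} * {ffun 'I_(2 * n) -> 'I_n}) :
    {ffun 'I_(2 * n) -> 'I_n * bool} := [ffun i => (x.2 i, x.1 i)].

Lemma seat_pairs_bij n : bijective (@seat_pairs n).
Proof.
exists (fun s : {ffun 'I_(2 * n) -> 'I_n * bool} =>
  ([ffun i => (s i).2] : {ffun 'I_(2 * n) -> bool},
   [ffun i => (s i).1] : {ffun 'I_(2 * n) -> 'I_n})).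
  by case=> w f; congr pair; apply/ffunP => i; rewrite !ffunE.
by move=> s; apply/ffunP => i; rewrite !ffunE /=; case: (s i).
Qed.

(** The condition on spouses is the product of the [1 - [f i = f (i + 1)]], expanded over all sets
    [D] of seats, markings or not. *)
Lemma admissible_seat_pairs (R : comNzRingType) n
    (w : {ffun 'I_(2 * n) -> bool}) (f : {ffun 'I_(2 * n) -> 'I_n}) :
  (admissible (seat_pairs (w, f)))%:R = (no_triple w)%:R *
    \sum_(D : {ffun 'I_(2 * n) -> bool}) (-1) ^+ #|[set i | D i]| *
      (f \in labelings w D)%:R :> R.
Proof.
have injE : injectiveb (seat_pairs (w, f)) =
    dinjectiveb f [set i | w i] && dinjectiveb f [set i | ~~ w i].
  apply/injectiveP/andP => [sI|[/dinjectiveP fm /dinjectiveP fw] i j].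
    split; apply/dinjectiveP => i j; rewrite !inE => wi wj fij;
      apply: sI; rewrite !ffunE /= fij.
      by rewrite wi wj.
    by rewrite (negPf wi) (negPf wj).
  rewrite !ffunE => -[fij wij].
  by case wi: (w i) (wij) => /esym wj; [apply: fm|apply: fw]; rewrite // inE ?wi ?wj.
have adjE : [forall i, (seat_pairs (w, f) i).1 != (seat_pairs (w, f) (ordS i)).1]
    = [forall i, f i != f (ordS i)].
  by apply: eq_forallb => i; rewrite !ffunE.
have tripleE : [forall i, ~~ (((seat_pairs (w, f) i).2 ==
      (seat_pairs (w, f) (ordS i)).2) && ((seat_pairs (w, f) (ordS i)).2 ==
      (seat_pairs (w, f) (ordS (ordS i))).2))] = no_triple w.
  by apply: eq_forallb => i; rewrite !ffunE.
rewrite /admissible injE adjE tripleE andbA andbC -mulnb natrM; congr (_ * _).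
under eq_bigr do rewrite inE andbA -mulnb natrM mulrCA.
rewrite -mulr_sumr -prod_sub_indicator -mulnb natrM; congr (_ * _).
case: (boolP [forall i, f i != _]) => [/forallP fD|].
  by rewrite big1 // => i _; rewrite (negPf (fD i)) subr0.
rewrite negb_forall => /existsP[i]; rewrite negbK => fi.
by rewrite (bigD1 i) //= fi subrr mul0r.
Qed.

Lemma menage_T_config (R : comNzRingType) n : (1 < n)%N ->
  (menage_T n)%:R = n`!%:R *
    \sum_(w : {ffun 'I_(2 * n) -> bool} | no_triple w && (#|[set i | w i]| == n))
      \sum_(D : {ffun 'I_(2 * n) -> bool} | couple_marking w D)
        (-1) ^+ #|[set i | D i]| * (n - #|[set i | D i]|)`!%:R :> R.
Proof.
move=> n1; rewrite /menage_T -sum1_card natr_sum big_mkcond /=.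
transitivity (\sum_(s : {ffun 'I_(2 * n) -> 'I_n * bool})
    (admissible s)%:R : R).
  by apply: eq_bigr => s _; rewrite inE; case: admissible.
rewrite (reindex (@seat_pairs n)) /=; last exact/onW_bij/seat_pairs_bij.
rewrite -(pair_bigA _ (fun w f => (admissible (seat_pairs (w, f)))%:R)) /=.
rewrite mulr_sumr [RHS]big_mkcond; apply: eq_bigr => w _.
under eq_bigr do rewrite admissible_seat_pairs.
rewrite -mulr_sumr exchange_big /=.
have labE (D : {ffun 'I_(2 * n) -> bool}) :
    \sum_f (-1) ^+ #|[set i | D i]| * (f \in labelings w D)%:R =
    (-1) ^+ #|[set i | D i]| * #|labelings w D|%:R :> R.
  rewrite -mulr_sumr; congr (_ * _).
  rewrite -sum1_card natr_sum [in RHS]big_mkcond.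
  by apply: eq_bigr => f _; case: (_ \in _).
under eq_bigr do rewrite labE card_labelings //.
case: (no_triple w); rewrite ?mul0r // mul1r /=.
case: (_ == n) => /=; last by rewrite big1 // => D _; rewrite mulr0.
rewrite mulr_sumr [RHS]big_mkcond; apply: eq_bigr => D _.
by case: couple_marking; rewrite ?mulr0 // natrM mulrCA.
Qed.

(** * The two Laplace transforms *)

Section Moments.
Local Open Scope classical_set_scope.
Local Open Scope ring_scope.
Variable R : realType.
Implicit Types (k : nat) (x : R).
Local Notation mu := (@lebesgue_measure R).

(* [- exp_factor k x * exp (- x)] is a primitive of [x ^ k * exp (- x)]. *)
Fixpoint exp_factor k x : R :=
  if k is j.+1 then x ^+ k + k%:R * exp_factor j x else 1.

Lemma exp_factor0 k : exp_factor k 0 = k`!%:R.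
Proof.
by elim: k => //= k ->; rewrite expr0n add0r -natrM factS.
Qed.

Lemma is_derive_exp_factor k x :
  is_derive x 1 (exp_factor k) (exp_factor k x - x ^+ k).
Proof.
elim: k => [|k IHk].
  by rewrite /= subrr; exact: is_derive_cst.
have fE : exp_factor k.+1 = (@id R) ^+ k.+1 + k.+1%:R *: exp_factor k.
  by apply/funext => z; rewrite !fctE.
have dX : is_derive x 1 ((@id R) ^+ k.+1) ((k.+1%:R * x ^+ k) *: 1).
  exact: is_deriveX.
have dK := is_deriveD dX (is_deriveZ k.+1%:R IHk).
rewrite {1}fE; apply: (is_derive_eq dK).
by rewrite /GRing.scale /= exprS; ring.
Qed.

Lemma is_derive_exp_primitive k x :
  is_derive x 1 (fun z => - (exp_factor k z * expR (- z))) (x ^+ k * expR (- x)).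
Proof.
have df := is_derive_exp_factor k x.
have de : is_derive x 1 (fun z : R => expR (- z)) (- expR (- x)).
  have dN := is_derive1_comp (is_derive_expR (- x)) (is_deriveN (is_derive_id x 1)).
  by apply: (is_derive_eq dN); rewrite mulrN1.
have -> : (fun z => - (exp_factor k z * expR (- z))) =
    - (exp_factor k * (fun z : R => expR (- z))) by [].
apply: (is_derive_eq (is_deriveN (is_deriveM df de))).
by rewrite /GRing.scale /=; ring.
Qed.

(** The bound [(k+1)! / x] follows from [exp x >= 1 + x^(k+1) / (k+1)!]. *)
Lemma cvg_exprM_expRN k : x ^+ k * expR (- x) @[x --> +oo] --> (0 : R).
Proof.
have cvg_inv : k.+1`!%:R * x^-1 @[x --> +oo] --> (0 : R).
  rewrite -[X in _ --> X](mulr0 (k.+1`!%:R)); apply: cvgMr.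
  by apply/(@gtr0_cvgV0 _ _ _ _ id) => //; apply: nbhs_pinfty_gt.
apply: (squeeze_cvgr _ (cvg_cst 0) cvg_inv); near=> x.
have x0 : 0 < x by near: x; apply: nbhs_pinfty_gt.
have x0' := ltW x0; rewrite mulr_ge0 ?exprn_ge0 ?expR_ge0 //=.
rewrite expRN ler_pdivrMr ?expR_gt0 // mulrAC ler_pdivlMr // -exprSr.
rewrite -ler_pdivrMl ?ltr0n ?fact_gt0 // mulrC.
by have := expR_ge1Dxn k x0'; lra.
Unshelve. all: by end_near. Qed.

Lemma cvg_exp_factor k : exp_factor k x * expR (- x) @[x --> +oo] --> (0 : R).
Proof.
elim: k => [|k IHk]; first by under eq_fun do rewrite mul1r; exact: cvgr_expR.
have -> : (fun x => exp_factor k.+1 x * expR (- x)) = (fun x =>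
    x ^+ k.+1 * expR (- x) + k.+1%:R * (exp_factor k x * expR (- x))).
  by apply/funext => x /=; rewrite mulrDl mulrA.
rewrite -[X in _ --> X](addr0 0) -[X in _ --> _ + X](mulr0 k.+1%:R).
apply: cvgD; [exact: cvg_exprM_expRN|exact: cvgMr].
Qed.

Lemma continuous_exprM_expRN k : continuous (fun x => x ^+ k * expR (- x)).
Proof.
move=> x; apply: cvgM; first exact: exprn_continuous.
apply: (@continuous_comp _ _ _ -%R expR); first exact: opp_continuous.
exact: continuous_expR.
Qed.

Lemma integral_exprM_expRN k :
  (\int[mu]_(x in `[0%R, +oo[) (x ^+ k * expR (- x))%:E = k`!%:R%:E)%E.
Proof.
rewrite (@ge0_continuous_FTC2y _ _
  (fun z => - (exp_factor k z * expR (- z))) _ 0).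
- by rewrite exp_factor0 oppr0 expR0 mulr1 EFinN oppeK add0e.
- by move=> x x0; rewrite mulr_ge0 ?exprn_ge0 ?expR_ge0.
- by apply: continuous_subspaceT; exact: continuous_exprM_expRN.
- by rewrite -oppr0; apply: cvgN; exact: cvg_exp_factor.
- by move=> x _; have /@ex_derive := is_derive_exp_primitive k x.
- apply: cvg_at_right_filter.
  have /@ex_derive/derivable1_diffP/differentiable_continuous :=
    is_derive_exp_primitive k 0.
  exact.
- by move=> x _; rewrite derive1E; have /@derive_val := is_derive_exp_primitive k x.
Qed.

Lemma integrable_exprM_expRN k :
  mu.-integrable `[0%R, +oo[ (EFin \o (fun x => x ^+ k * expR (- x))).
Proof.
apply/integrableP; split.
  apply/measurable_EFinP; apply: measurable_funTS.
  apply: continuous_measurable_fun; exact: continuous_exprM_expRN.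
rewrite (_ : \int[mu]_(x in _) _ =
    \int[mu]_(x in `[0%R, +oo[) (x ^+ k * expR (- x))%:E)%E.
  by rewrite integral_exprM_expRN ltry.
apply: eq_integral => x; rewrite inE /= in_itv /= andbT => x0.
by rewrite ger0_norm // mulr_ge0 ?exprn_ge0 ?expR_ge0.
Qed.

Lemma Rintegral_horner_expRN (q : {poly R}) :
  \int[mu]_(x in `[0%R, +oo[) (q.[x] * expR (- x)) = \sum_(k < size q) q`_k * k`!%:R.
Proof.
rewrite /Rintegral.
have -> : (\int[mu]_(x in `[0%R, +oo[) (q.[x] * expR (- x))%:E =
   \int[mu]_(x in `[0%R, +oo[)
     \sum_(k < size q) ((q`_k)%:E * (x ^+ k * expR (- x))%:E))%E.
  apply: eq_integral => x _; rewrite horner_coef mulr_suml sumEFin.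
  by congr EFin; apply: eq_bigr => k _; rewrite mulrA.
rewrite integral_sum //; last first.
  by move=> k; apply: integrableZl => //; exact: integrable_exprM_expRN.
under eq_bigr => k _.
  rewrite integralZl //; last exact: integrable_exprM_expRN.
  rewrite integral_exprM_expRN; over.
by rewrite sumEFin.
Qed.
End Moments.

(** * Principal values and the exponential integral *)

Section ExponentialIntegral.
Local Open Scope classical_set_scope.
Local Open Scope ring_scope.
Variable R : realType.
Implicit Types (c e s t z : R) (f : R -> R) (D : set R).
Local Notation mu := (@lebesgue_measure R).

(** An infinite integral stays infinite under scaling, and [fine] sends it to 0 on both sides. *)
Lemma ge0_RintegralZl D f c : measurable D -> 0 < c ->
  measurable_fun D f -> (forall x, D x -> 0 <= f x) ->
  \int[mu]_(x in D) (c * f x) = c * \int[mu]_(x in D) f x.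
Proof.
move=> mD c0 mf f0; rewrite /Rintegral.
under eq_integral do rewrite EFinM.
rewrite ge0_integralZl_EFin; [|by []| | |exact: ltW]; last 2 first.
- by move=> x Dx; rewrite lee_fin f0.
- exact/measurable_EFinP.
case: (\int[mu]_(x in D) (f x)%:E)%E => [r||] /=; first by [].
- by rewrite mulry gtr0_sg // mul1e mulr0.
- by rewrite mulrNy gtr0_sg // mul1e mulr0.
Qed.

(* No convergence is assumed: the junk value of a divergent limit is [0]. *)
Lemma lim_mull (F : set_system R) (FF : ProperFilter F) (g : R -> R) c :
  c != 0 -> lim (c * g x @[x --> F]) = c * lim (g x @[x --> F]).
Proof.
move=> c0; have [cg|ncg] := pselect (cvg (g x @[x --> F])).
  by apply/cvg_lim => //; apply: cvgMr.
have ncg' : ~ cvg (c * g x @[x --> F]).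
  apply: contra_not ncg => cg.
  have -> : g = (fun x => c^-1 * (c * g x)).
    by apply/funext => x; rewrite mulrA mulVf // mul1r.
  exact: is_cvgMr.
rewrite (dvgP ncg) (dvgP ncg'); exact: esym (mulr0 c).
Qed.

Lemma derive1_subl z : (fun t : R => z - t)^`()%classic = cst (-1).
Proof.
apply/funext => t; rewrite derive1E.
have d := is_deriveB (is_derive_cst z t 1) (is_derive_id t 1).
by rewrite (@derive_val _ _ _ _ _ _ _ d) sub0r.
Qed.

Lemma continuous_subl z : continuous (fun t : R => z - t).
Proof. by move=> t; apply: cvgB; [exact: cvg_cst|exact: cvg_id]. Qed.

Lemma continuous_exp_div s : s != 0 -> {for s, continuous (fun s : R => expR s / s)}.
Proof.
move=> s0; apply: cvgM; first exact: continuous_expR.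
exact: cvgV.
Qed.

Lemma measurable_exp_div (D : set R) :
  measurable D -> (forall x, D x -> x != 0) ->
  measurable_fun D (fun s : R => expR s / s).
Proof.
move=> mD D0; apply: subspace_continuous_measurable_fun => //.
apply: continuous_in_subspaceT => s; rewrite inE => /D0.
exact: continuous_exp_div.
Qed.

(** Substitution [s = z - t], with [exp (- t) = exp (- z) exp s]. *)
Lemma laplace_geom_left z e : 0 < e ->
  \int[mu]_(t in `[0%R, (z - e)%R]) (expR (- t) / (z - t))
  = expR (- z) * \int[mu]_(s in `[e, z]) (expR s / s).
Proof.
(* If [z < e], both intervals are empty. *)
move=> e0; have [ze|ez] := ltP z e.
  rewrite !set_itv_ge ?bnd_simp ?ltNge //; last 2 first.
  - by rewrite -ltNge.
  - by rewrite -ltNge subr_lt0.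
  by rewrite !Rintegral_set0 mulr0.
have mG : measurable_fun `[e, z] (fun s : R => expR s / s).
  apply: measurable_exp_div => // x; rewrite /= in_itv /= => /andP[ex _].
  by rewrite gt_eqF // (lt_le_trans e0).
rewrite -ge0_RintegralZl ?expR_gt0 //; last first.
  move=> s; rewrite /= in_itv /= => /andP[es _].
  by rewrite divr_ge0 ?expR_ge0 // (le_trans (ltW e0)).
have := @integration_by_substitution_decreasing R (fun t => z - t)
  (fun s => expR (- z) * (expR s / s)) 0 (z - e).
rewrite subr0 opprB addrCA subrr addr0 => subst.
rewrite /Rintegral subst; last first.
- apply: continuous_in_subspaceT => s; rewrite inE /= in_itv /= => /andP[es _].
  apply: cvgMr; apply: continuous_exp_div.
  by rewrite gt_eqF // (lt_le_trans e0).
- split.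
  + by move=> t _; apply: derivableB; [exact: derivable_cst|exact: derivable_id].
  + apply: cvg_at_right_filter; exact: continuous_subl.
  + apply: cvg_at_left_filter; exact: continuous_subl.
- rewrite derive1_subl; exact: is_cvg_cst.
- rewrite derive1_subl; exact: is_cvg_cst.
- by rewrite derive1_subl => t _; exact: cvg_cst.
- by move=> s t _ _ st; rewrite ltrD2l ltrN2.
- by rewrite subr_ge0.
congr fine; apply: eq_integral => t _; congr EFin.
rewrite derive1_subl /= !fctE /= opprK mulr1.
by rewrite mulrA -expRD; congr (expR _ / _); ring.
Qed.

(** The same substitution; the integrand is negative on this side, so signs are changed to integrate
    non-negative functions. *)
Lemma laplace_geom_right z e : 0 < e ->
  \int[mu]_(t in `[(z + e)%R, +oo[) (expR (- t) / (z - t))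
  = expR (- z) * \int[mu]_(s in `]-oo, (- e)%R]) (expR s / s).
Proof.
move=> e0.
have neg s : s <= - e -> s < 0.
  by move=> se; rewrite (le_lt_trans se) // oppr_lt0.
have mG : measurable_fun `]-oo, (- e)%R] (fun s : R => expR s / s).
  apply: measurable_exp_div => // x; rewrite /= in_itv /= => /neg x0.
  by rewrite lt_eqF.
have ge0 s : s <= - e -> 0 <= - (expR s / s).
  by move=> /neg s0; rewrite oppr_ge0 mulr_ge0_le0 ?expR_ge0 // invr_le0 ltW.
have RN D f : (forall x, D x -> 0 <= f x) ->
    \int[mu]_(x in D) (- f x) = - \int[mu]_(x in D) f x.
  by move=> f0; rewrite /Rintegral -fineN -integral_ge0N.
have -> : \int[mu]_(s in `]-oo, (- e)%R]) (expR s / s) =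
    - \int[mu]_(s in `]-oo, (- e)%R]) (- (expR s / s)).
  rewrite -RN; first by apply: eq_Rintegral => s _; rewrite opprK.
  by move=> s; rewrite /= in_itv /=; exact: ge0.
have mG' : measurable_fun `]-oo, (- e)%R] (fun s : R => - (expR s / s)).
  exact: measurableT_comp.
have ge0' s : [set` `]-oo, (- e)%R]] s -> 0 <= - (expR s / s).
  by rewrite /= in_itv /=; exact: ge0.
rewrite mulrN -ge0_RintegralZl ?expR_gt0 //.
have := @decreasing_ge0_integration_by_substitutiony R (fun t => z - t)
  (fun s => expR (- z) * - (expR s / s)) (z + e).
rewrite opprD addrA subrr add0r => subst.
rewrite [in RHS]/Rintegral subst; last first.
- move=> s; rewrite in_itv /= => se; rewrite mulr_ge0 ?expR_ge0 // ge0 //=.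
  exact: ltW.
- apply: continuous_in_subspaceT => s; rewrite inE /= in_itv /= => /neg s0.
  by apply: cvgMr; apply: cvgN; apply: continuous_exp_div; rewrite lt_eqF.
- apply/cvgrNyPle => A; near=> t.
  have : z - A <= t by near: t; apply: nbhs_pinfty_ge; exact: num_real.
  by lra.
- split.
  + by move=> t _; apply: derivableB; [exact: derivable_cst|exact: derivable_id].
  + apply: cvg_at_right_filter; exact: continuous_subl.
- rewrite derive1_subl; exact: is_cvg_cst.
- rewrite derive1_subl; exact: is_cvg_cst.
- by rewrite derive1_subl => t _; exact: cvg_cst.
- by move=> s t _ _ st; rewrite ltrD2l ltrN2.
have FE t : (((fun s => expR (- z) * - (expR s / s)) \o (fun t => z - t)) *
    - (fun t : R => z - t)^`()%classic) t = - (expR (- t) / (z - t)).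
  rewrite derive1_subl /= !fctE /= opprK mulr1 mulrN; congr (- _).
  by rewrite mulrA -expRD; congr (expR _ / _); ring.
rewrite (_ : fine _ = \int[mu]_(t in `[(z + e)%R, +oo[) - (expR (- t) / (z - t))).
  rewrite -RN; first by apply: eq_Rintegral => t _; rewrite opprK.
  move=> t; rewrite /= in_itv /= andbT => zet.
  by rewrite oppr_ge0 mulr_ge0_le0 ?expR_ge0 // invr_le0; lra.
by congr fine; apply: eq_integral => t _; rewrite FE.
Unshelve. all: by end_near. Qed.

Lemma laplace_geomE z : laplace_geom z = expR (- z) * Ei z.
Proof.
rewrite /laplace_geom /Ei -lim_mull ?gt_eqF ?expR_gt0 //.
set f := fun _ => _; set g := fun _ => _.
have fg : \forall e \near (0 : R)^'+, f e = g e.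
  near=> e; have e0 : 0 < e by near: e; exact: nbhs_right_gt.
  by rewrite /f /g laplace_geom_left // laplace_geom_right // -mulrDr addrC.
(* Functions equal near [0+] have the same image filter, convergent or not. *)
suff -> : f e @[e --> (0 : R)^'+] = g e @[e --> (0 : R)^'+] by [].
apply/seteqP; split; apply: near_eq_cvg => //.
by apply: filterS fg => e ->.
Unshelve. all: by end_near. Qed.

Lemma taylor0_laplace_geom :
  taylor0 (fun x : R => laplace_geom (x + 2)) =
  taylor0 (fun x : R => expR (- x - 2) * Ei (x + 2)).
Proof.
congr taylor0; apply/funext => x; rewrite laplace_geomE; congr (expR _ * _).
by rewrite opprD.
Qed.
End ExponentialIntegral.

(** * Coefficients of the generating function *)

Section Coefficients.
Variables (K : fieldType) (t : K).
Hypothesis t_neq0 : t != 0.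
Let P : pser K := poly_pser 'X.
Let T : pser K := poly_pser t%:P.

Definition config_gf : pser K := strip_coef t 0 (config_series (- t^-1)).

Lemma config_gf1 : pcoef config_gf 1 = - 2 * (2 - t).
Proof. exact: config_strip_coef1. Qed.

(** [t^n (- 1 / t)^|D| = (-1)^|D| t^(n - |D|)]. *)
Lemma config_gf_sum n : (0 < n)%N -> pcoef config_gf n =
  \sum_(w : {ffun 'I_(2 * n) -> bool} | no_triple w && (#|[set i | w i]| == n))
    \sum_(D : {ffun 'I_(2 * n) -> bool} | couple_marking w D)
      (-1) ^+ #|[set i | D i]| * t ^+ (n - #|[set i | D i]|).
Proof.
move=> n0; rewrite /config_gf pcoef_strip !addn0.
rewrite (_ : pcoef _ _ = config_poly (- t^-1) (2 * n)); last by case: n n0.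
rewrite coef_config_poly mulr_sumr; apply: eq_bigr => w /andP[_ /eqP wn].
rewrite mulr_sumr; apply: eq_bigr => D wD.
(* There are no more marked pairs than women. *)
have Dn : (#|[set i | D i]| <= n)%N.
  rewrite -(card_covered_women wD).
  have cW : #|~: [set i | w i]| = n.
    have := cardsC [set i | w i]; rewrite card_ord wn.
    by move: #|~: _| => c; lia.
  rewrite -[X in (_ <= X)%N]cW; apply: subset_leq_card.
  by apply/fintype.subsetP => i; rewrite !inE => /andP[].
rewrite (exprNn t^-1) mulrCA exprVn -expfB_cond //.
by rewrite (negPf t_neq0).
Qed.
Hypotheses (two : 2 != 0 :> K) (t2 : 2 - t != 0).

Lemma config_gfE : config_gf = - 6 + pole_part t + egf_pser t.
Proof.
by apply: config_strip_closed_form => //; [apply: pole_partE|apply: egf_pserE].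
Qed.

Lemma pole_part0 : pcoef (pole_part t) 0 = 3.
Proof.
have := congr1 (fun f => pcoef f 0) (pole_partE t2).
rewrite (pcoefM0 (_ - _)) pole_den0 pcoefD pcoefB (pcoef_poly 'X) coefX sub0r.
rewrite -!(rmorph_nat (@poly_pser K)) -!polyC_natr pcoefCM !pcoef_poly !coefC /=.
rewrite (_ : - (3 * t) + 6 = (2 - t) * 3); last by ring.
by move/(mulfI t2).
Qed.

(** Expansion of [(p - 3 t + 6) / (2 + p - t) = 3 - 2 p / (p + (2 - t))]. *)
Lemma pole_partS n :
  pcoef (pole_part t) n.+1 = - 2 * (-1) ^+ n / (2 - t) ^+ n.+1.
Proof.
have E m : (2 - t) * pcoef (pole_part t) m.+1 + pcoef (pole_part t) m = (m == 0%N)%:R.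
  have : pcoef ((2 + P - T) * pole_part t) m.+1 = pcoef (P - 3 * T + 6) m.+1.
    by rewrite pole_partE.
  rewrite (_ : (2 + P - T) * _ = poly_pser (2 - t)%:P * pole_part t
      + poly_pser 'X * pole_part t); last first.
    by rewrite polyCB rmorphB polyC_natr rmorph_nat; ring.
  rewrite [X in X = _ -> _]pcoefD pcoefCM pcoefXM => ->.
  rewrite pcoefD pcoefB -!(rmorph_nat (@poly_pser K)) -!polyC_natr pcoefCM.
  by rewrite !pcoef_poly !coefC coefX /= mulr0 subr0 addr0 eqSS.
elim: n => [|n IHn].
  have := E 0%N; rewrite pole_part0 /= mulr1n => E0; apply: (mulfI t2).
  rewrite expr0 expr1 mulr1 [RHS]mulrCA divff // mulr1.
  by rewrite -[LHS](addrK 3) E0; ring.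
have := E n.+1; rewrite IHn /= mulr0n => En; apply: (mulfI t2).
rewrite -[LHS](addrK (- 2 * (-1) ^+ n / (2 - t) ^+ n.+1)) En.
rewrite [(2 - t) ^+ n.+2]exprS [(-1) ^+ n.+1]exprS; field.
by rewrite expf_neq0 // t2.
Qed.

(** The constant terms in [config_gfE] are [0 = - 6 + 3 + 3]. *)
Lemma egf_coef0 : pcoef (egf_pser t) 0 = 3.
Proof.
have g0 : pcoef config_gf 0 = 0 by rewrite /config_gf pcoef_strip coef0 mulr0.
have E : pcoef config_gf 0 = - 6 + 3 + pcoef (egf_pser t) 0.
  rewrite config_gfE !pcoefD pole_part0 pcoefN -(rmorph_nat (@poly_pser K)).
  by rewrite pcoef_poly -polyC_natr coefC.
rewrite g0 in E; rewrite -[LHS](addKr (- 6 + 3)) -E; ring.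
Qed.

Lemma egf_coefS n : pcoef (egf_pser t) n.+1 =
  pcoef config_gf n.+1 + 2 * (-1) ^+ n / (2 - t) ^+ n.+1.
Proof.
rewrite config_gfE !pcoefD pole_partS pcoefN -(rmorph_nat (@poly_pser K)).
by rewrite pcoef_poly -polyC_natr coefC /=; ring.
Qed.

Lemma laurent_coefS n : lcoef (laurent_expr t) n.+1 = pcoef config_gf n.+1.
Proof.
rewrite lcoef_laurent_expr // config_gfE !pcoefD pcoefN.
rewrite -(rmorph_nat (@poly_pser K)) pcoef_poly -polyC_natr coefC /=; ring.
Qed.

End Coefficients.

(** * Laplace transforms of the coefficients and the numbers [T_n] *)

Section Menage.
Variable R : realType.
Local Notation tv := (@ratfun_poly R 'X).

Definition menage_poly (n : nat) : {poly R} :=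
  \sum_(w : {ffun 'I_(2 * n) -> bool} | no_triple w && (#|[set i | w i]| == n))
    \sum_(D : {ffun 'I_(2 * n) -> bool} | couple_marking w D)
      (-1) ^+ #|[set i | D i]| * 'X^(n - #|[set i | D i]|).

Lemma ratfun_menage_poly n : (0 < n)%N ->
  ratfun_poly (menage_poly n) = pcoef (config_gf tv) n.
Proof.
move=> n0; rewrite config_gf_sum ?ratfun_t_neq0 ?ratfun_nat_neq0 ?ratfun_2Bt_neq0 //.
rewrite /menage_poly rmorph_sum.
apply: eq_bigr => w _; rewrite rmorph_sum; apply: eq_bigr => D _.
by rewrite rmorphM rmorphXn rmorphN1 rmorphXn.
Qed.

Definition laplace_poly (q : {poly R}) : R := \sum_(k < size q) q`_k * k`!%:R.

Lemma laplace_polyE (q : {poly R}) m : (size q <= m)%N ->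
  laplace_poly q = \sum_(k < m) q`_k * k`!%:R.
Proof.
move=> qm; rewrite /laplace_poly (big_ord_widen _ (fun k => q`_k * k`!%:R) qm).
rewrite big_mkcond; apply: eq_bigr => k _; case: ltnP => // kq.
by rewrite nth_default ?mul0r.
Qed.

Lemma laplace_menage_poly n : (1 < n)%N ->
  (menage_T n)%:R = n`!%:R * laplace_poly (menage_poly n).
Proof.
move=> n1; rewrite menage_T_config //; congr (_ * _).
have coefE (w D : {ffun 'I_(2 * n) -> bool}) k :
    ((-1) ^+ #|[set i | D i]| * 'X^(n - #|[set i | D i]|) : {poly R})`_k =
    (-1) ^+ #|[set i | D i]| * (k == n - #|[set i | D i]|)%N%:R.
  by rewrite -polyCN -polyC_exp coefCM coefXn.
rewrite (@laplace_polyE _ n.+1); last first.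
  apply/leq_sizeP => k nk; rewrite coef_sum big1 // => w _.
  rewrite coef_sum big1 // => D _; rewrite coefE //.
  by rewrite gtn_eqF ?mulr0 // (leq_ltn_trans (leq_subr _ _)).
under [RHS]eq_bigr => k _.
  rewrite coef_sum mulr_suml; under eq_bigr => w _.
    rewrite coef_sum mulr_suml; under eq_bigr do rewrite coefE //. over.
  over.
rewrite exchange_big; apply: eq_bigr => w _.
rewrite exchange_big; apply: eq_bigr => D _ /=.
have nk : (n - #|[set i | D i]| < n.+1)%N by rewrite ltnS leq_subr.
rewrite (bigD1 (Ordinal nk)) //= eqxx mulr1 big1 ?addr0 // => k.
by rewrite -val_eqE /= => /negPf ->; rewrite mulr0 mul0r.
Qed.

(* The polynomial part for [n = 1] is [menage_poly 1] too, but its transform is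
   [-2] and not [T_1 = 0]; the term [2 'X] of the formula corrects this. *)
Definition egf_laplace (n : nat) : R :=
  if n is m.+1 then
    laplace_poly (if m is 0 then 2 * 'X - 4 else menage_poly n)
    + 2 * taylor0 (fun x => laplace_geom (x + 2)) m
  else 3.

Lemma formal_laplace_egf n : formal_laplace (egf_integrand R n) (egf_laplace n).
Proof.
rewrite egf_integrandE; case: n => [|m].
  exists 3, 0%N, (fun=> 0); rewrite !big_ord0 !addr0.
  rewrite egf_coef0 ?ratfun_t_neq0 ?ratfun_nat_neq0 ?ratfun_2Bt_neq0 //.
  split; first by rewrite rmorph_nat.
  by rewrite -polyC_natr size_polyC pnatr_eq0 big_ord1 coefC mulr1.
(* Only the pole of highest order occurs; its sign cancels the [(-1)^j] of [formal_laplace]. *)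
pose r (j : 'I_m.+1) : R := if j == ord_max then 2 * (-1) ^+ m else 0.
exists (if m is 0 then 2 * 'X - 4 else menage_poly m.+1), m.+1, r; split.
  rewrite egf_coefS ?ratfun_t_neq0 ?ratfun_nat_neq0 ?ratfun_2Bt_neq0 //; congr (_ + _).
    case: m {r} => [|m]; last by rewrite ratfun_menage_poly.
    by rewrite config_gf1 ?ratfun_t_neq0 // rmorphB rmorphM !rmorph_nat; ring.
  rewrite big_ord_recr /= big1 ?add0r => [|j _]; last first.
    by rewrite /r -val_eqE /= ltn_eqF // rmorph0 mul0r.
  rewrite /r eqxx ratfun_2Bt; congr (_ / _).
  by rewrite polyCM rmorphM polyC_natr rmorph_nat polyC_exp polyCN rmorphXn rmorphN1.
congr (_ + _); rewrite big_ord_recr /= big1 ?add0r => [|j _]; last first.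
  by rewrite /r -val_eqE /= ltn_eqF // mul0r.
by rewrite /r eqxx -mulrA (mulrA ((-1) ^+ m)) -expr2 sqrr_sign mul1r.
Qed.

Lemma menage_egf n : (menage_T n)%:R / n`!%:R =
  fps_poly (- 2 + 2 * 'X : {poly R}) n
  + fps_mul (fps_poly (- 2 * 'X : {poly R}))
      (taylor0 (fun x : R => expR (- x - 2) * Ei (x + 2))) n
  + egf_laplace n.
Proof.
rewrite -taylor0_laplace_geom; set tay := taylor0 _.
have -> : fps_mul (fps_poly (- 2 * 'X : {poly R})) tay n =
    - 2 * (if n is m.+1 then tay m else 0).
  rewrite -[LHS]/(pcoef (poly_pser _ * PSer tay) n).
  rewrite -polyC_natr -polyCN rmorphM -mulrA pcoefCM pcoefXM.
  by case: n.
rewrite /fps_poly -polyC_natr -polyCN coefD coefC coefCM coefX.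
(* Degree 0 reads [1 = - 2 + 3]. In higher degrees the [Ei] terms cancel; in degree 1 the term
   [2 'X] offsets the transform [- 2] of [2 'X - 4], and beyond only [menage_poly] remains. *)
case: n => [|[|n]].
- rewrite menage_T0 fact0 divr1 /egf_laplace /= ?mulr0n ?mulr1n; ring.
- have sz : (size (2 * 'X - 4 : {poly R})%R <= 2)%N.
    apply/leq_sizeP => -[|[|k]] // _.
    by rewrite -!polyC_natr coefB coefCM coefX coefC mulr0 subr0.
  rewrite menage_T1 mul0r /egf_laplace -/tay (laplace_polyE sz).
  rewrite !big_ord_recl big_ord0 !coefB -!polyC_natr !coefCM !coefX !coefC.
  rewrite /= fact0 (factS 0) fact0 ?mulr0n ?mulr1n; ring.
rewrite laplace_menage_poly // mulrC mulKf; last by rewrite pnatr_eq0 -lt0n fact_gt0.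
by rewrite /egf_laplace -/tay /=; ring.
Qed.
End Menage.

(** * The integral formula and the exponential generating function *)

Local Open Scope classical_set_scope.
Local Open Scope ring_scope.

Theorem theorem3 (R : realType) :
  (forall n : nat, (1 < n)%N ->
     exists q : {poly R},
       lcoef (T_series R) n = ratfun_poly q /\
       (menage_T n)%:R = n`!%:R *
         \int[lebesgue_measure]_(t in `[(0 : R), +oo[) (q.[t] * expR (- t)))
  /\
  (exists v : fps R,
     (forall n : nat, formal_laplace (egf_integrand R n) (v n)) /\
     (forall n : nat,
        (menage_T n)%:R / n`!%:R =
          fps_poly (- 2 + 2 * 'X : {poly R}) n
          + fps_mul (fps_poly (- 2 * 'X : {poly R}))
              (taylor0 (fun x : R => expR (- x - 2) * Ei (x + 2))) n
          + v n)).
Proof.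
split; last first.
  by exists (@egf_laplace R); split; [exact: formal_laplace_egf|exact: menage_egf].
case=> [//|n] n1; exists (menage_poly R n.+1); split.
  (* [T_series] is convertible to [laurent_expr] at the variable of [R(t)]. *)
  rewrite ratfun_menage_poly // -[LHS]/(lcoef (laurent_expr (@ratfun_poly R 'X)) _).
  exact: (laurent_coefS (ratfun_t_neq0 R) (ratfun_nat_neq0 R 1) (ratfun_2Bt_neq0 R)).
by rewrite Rintegral_horner_expRN laplace_menage_poly.
Qed.
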